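(* Let $(u_K^n)$ be the values of an approximate solution of problem $(P)$ given by the implicit finite volume scheme described in the context. Then for all $k\in[0,u_{\max}]$, all $K\in\mathcal O$ and all $n\ge0$ the following discrete sub-entropy inequality holds: $$\frac{\eta_k^+(u_K^{n+1})-\eta_k^+(u_K^n)}{\delta t}m(K)+\sum_{\sigma\in\varepsilon_K}\Phi^+_{K,\sigma,k}(u_K^{n+1},u_{K,\sigma}^{n+1})-\sum_{L\in\mathcal N(K)}\tau_{K|L}\Big(\eta^+_{\phi(k)}(\phi(u_L^{n+1}))-\eta^+_{\phi(k)}(\phi(u_K^{n+1}))\Big)$$ $$\le\sum_{\sigma\in\varepsilon_K^{ext}}\operatorname{sign}^+(u_K^{n+1}-k)\,m(\sigma)\,f(k)\cdot n_{K,\sigma}.$$ The discrete super-entropy inequalities also hold, i.e. the same inequality with $\eta^+_k,\eta^+_{\phi(k)},\Phi^+_{K,\sigma,k},\operatorname{sign}^+$ replaced respectively by $\eta^-_k,\eta^-_{\phi(k)},\Phi^-_{K,\sigma,k},\operatorname{sign}^-$.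
   Context: Data. Let $\ell\ge1$, $\Omega\subset\mathbb R^\ell$ a bounded open set with Lipschitz boundary, $\eta$ the outward unit normal to $\partial\Omega$, $T>0$, $Q=(0,T)\times\Omega$, $u_{\max}>0$. The function $f:[0,u_{\max}]\to\mathbb R^\ell$ is continuous with $f(0)=f(u_{\max})=0$. The function $\phi$ is nondecreasing and Lipschitz on $[0,u_{\max}]$, and for some $u_c\in[0,u_{\max}]$, $\phi\equiv0$ on $[0,u_c]$ and $\phi$ is strictly increasing on $[u_c,u_{\max}]$. The couple $(f,\phi)$ is non-degenerate: for every $\xi\in\mathbb R^\ell\setminus\{0\}$ the function $\lambda\mapsto\sum_{i}\xi_i f_i(\lambda)$ is not affine on any non-degenerate subinterval of $[0,u_c]$. The initial datum $u_0:\Omega\to[0,u_{\max}]$ is measurable. Problem $(P)$: $u_t+\operatorname{div}f(u)-\Delta\phi(u)=0$ in $Q$, $u(0,\cdot)=u_0$ in $\Omega$, $(f(u)-\nabla\phi(u))\cdot\eta=0$ on $(0,T)\times\partial\Omega$. Entropies. $a\bot b=\min(a,b)$, $a\top b=\max(a,b)$; $\eta_k^+(s)=s\top k-k=\max(s-k,0)$, $\eta_k^-(s)=k-s\bot k=\max(k-s,0)$; $\operatorname{sign}^+(r)=1$ if $r>0$ and $0$ otherwise; $\operatorname{sign}^-(r)=-1$ if $r<0$ and $0$ otherwise; $\Phi^+_{K,\sigma,k}(a,b)=F_{K,\sigma}(a\top k,b\top k)-F_{K,\sigma}(k,k)$; $\Phi^-_{K,\sigma,k}(a,b)=F_{K,\sigma}(k,k)-F_{K,\sigma}(a\bot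 k,b\bot k)$. Mesh. $\mathcal O$ is a finite family of disjoint connected polygonal (polyhedral) control volumes $K\subset\Omega$ whose closures cover $\overline\Omega$, the common interface of two control volumes being contained in a hyperplane; $h=\sup_K\operatorname{diam}K$. For a fixed $\alpha>0$: $\alpha h^\ell\le m(K)$ and $m(\partial K)\le\frac1\alpha h^{\ell-1}$ for all $K$ (hence $|\mathcal O|\le\frac{m(\Omega)}{\alpha}h^{-\ell}$), $m$ denoting $\ell$- or $(\ell-1)$-dimensional measure. $\mathcal N(K)$ is the set of neighbours of $K$; $K|L$ is the common interface of $K$ and $L\in\mathcal N(K)$; $\bar\varepsilon_K$ is the set of all edges of $K$, $\varepsilon_K^{ext}$ the set of those on $\partial\Omega$, $\varepsilon_K=\bar\varepsilon_K\setminus\varepsilon_K^{ext}$ (the interfaces $K|L$, $L\in\mathcal N(K)$); $n_{K,\sigma}$ is the unit normal to $\sigma$ outward to $K$. The mesh is admissible: there are points $x_K\in K$ such that the line $x_Kx_L$ is orthogonal to $K|L$; $d_{K,L}=|x_K-x_L|$, $\tau_{K|L}=m(K|L)/d_{K,L}$. Numerical fluxes. For $K\in\mathcal O$, $\sigma\in\bar\varepsilon_K$, $F_{K,\sigma}:\mathbb R^2\to\mathbb R$ is continuous and: (monotone) nondecreasing in its first and nonincreasing in its second variable; (conservative) $F_{K,L}(a,b)=-F_{L,K}(b,a)$ for $\sigma=K|L$ (where $F_{K,L}=F_{K,K|L}$); (regular) Lipschitz in each variable on $[0,u_{\max}]^2$ with constant $m(\sigma)M$, $M$ fixed; (consistent)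 $F_{K,\sigma}(s,s)=m(\sigma)f(s)\cdot n_{K,\sigma}$ for $s\in[0,u_{\max}]$. $\phi$ is extended to $\mathbb R$ as a continuous nondecreasing function. Scheme. With time step $\delta t>0$: $u_K^0=\frac1{m(K)}\int_Ku_0\,dx$, and for all $n\ge0$, $K\in\mathcal O$, $$m(K)\frac{u_K^{n+1}-u_K^n}{\delta t}+\sum_{L\in\mathcal N(K)}F_{K,L}(u_K^{n+1},u_L^{n+1})-\sum_{L\in\mathcal N(K)}\tau_{K|L}\big(\phi(u_L^{n+1})-\phi(u_K^{n+1})\big)=0.$$ We write $u_{K,\sigma}^{n+1}=u_L^{n+1}$ for $\sigma=K|L$. *)

(* Defs.v *)
From HB Require Import structures.
From mathcomp Require Import all_boot all_order all_algebra finmap.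
From mathcomp Require Import all_classical all_reals all_analysis.

Set Implicit Arguments.
Unset Strict Implicit.
Unset Printing Implicit Defensive.

Import Order.TTheory GRing.Theory Num.Theory.
Import numFieldNormedType.Exports.

Local Open Scope classical_set_scope.
Local Open Scope ring_scope.

(** * Lebesgue measure on ['rV[R]_l]

    The Borel measure on [l.-tuple R] is the iterated product of the
    one-dimensional [lebesgue_measure]; its outer measure is transported to
    row vectors, where Caratheodory's construction gives the complete Lebesgue
    measure.  On sets that are not Lebesgue measurable, [lebesgue_rV] is the
    Lebesgue outer measure. *)

Section tuple_measure.
Context (R : realType) (n : nat).
Local Notation Rm := (measurableTypeR R).
Variable mu : {sigma_finite_measure set (n.-tuple Rm) -> \bar R}.

Definition cons_pair (p : Rm * n.-tuple Rm) : n.+1.-tuple Rm :=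
  [the n.+1.-tuple Rm of p.1 :: p.2].

Lemma measurable_cons_pair : measurable_fun setT cons_pair.
Proof. by apply: measurable_cons; [exact: measurable_fst|exact: measurable_snd]. Qed.

Definition tuple_step : set (n.+1.-tuple Rm) -> \bar R :=
  pushforward (@lebesgue_measure R \x mu)%E cons_pair.

Let tuple_step0 : tuple_step set0 = 0%E.
Proof. by rewrite /tuple_step /pushforward preimage_set0 measure0. Qed.

Let tuple_step_ge0 A : (0 <= tuple_step A)%E.
Proof. by rewrite /tuple_step /pushforward measure_ge0. Qed.

Let tuple_step_sigma_additive : semi_sigma_additive tuple_step.
Proof.
move=> F mF tF mUF; rewrite /tuple_step /pushforward preimage_bigcup.
have mpre A : measurable A -> measurable (cons_pair @^-1` A).
  by move=> mA; rewrite -[X in measurable X]setTI; exact: measurable_cons_pair.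
apply: measure_semi_sigma_additive.
- by move=> i; exact: mpre.
- apply/trivIsetP => /= i j _ _ ij; rewrite -preimage_setI.
  by move/trivIsetP : tF => /(_ _ _ _ _ ij) ->//; rewrite preimage_set0.
- by rewrite -preimage_bigcup; exact: mpre.
Qed.

HB.instance Definition _ := isMeasure.Build _ _ _ tuple_step
  tuple_step0 tuple_step_ge0 tuple_step_sigma_additive.

Let tuple_step_sigma_finite : sigma_finite setT tuple_step.
Proof.
have /sigma_finiteP[F [TF ndF Foo]] := sigma_finiteT (@lebesgue_measure R).
have /sigma_finiteP[G [TG ndG Goo]] := sigma_finiteT mu.
pose g (t : n.+1.-tuple Rm) : Rm * n.-tuple Rm := (tnth t ord0, [tuple of behead t]).
have gK : cancel cons_pair g.
  move=> [x t]; rewrite /g /cons_pair/= (tnth_nth x)/=; congr pair.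
  exact: val_inj.
have mg : measurable_fun setT g.
  apply/measurable_fun_pairP; split.
  - exact: (@measurable_tnth _ _ _ ord0).
  - exact: measurable_behead.
exists (fun k => g @^-1` (F k `*` G k)).
  rewrite predeqE => t; split => // _.
  have [i _ Fi] : (\bigcup_i F i) (g t).1 by rewrite -TF.
  have [j _ Gj] : (\bigcup_i G i) (g t).2 by rewrite -TG.
  exists (maxn i j) => //; split.
  - by move: Fi; exact/subsetPset/ndF/leq_maxl.
  - by move: Gj; exact/subsetPset/ndG/leq_maxr.
move=> k; have [mF Fk] := Foo k; have [mG Gk] := Goo k; split.
  by rewrite -[X in measurable X]setTI; apply: mg => //; exact: measurableX.
rewrite /tuple_step /pushforward -comp_preimage (_ : g \o cons_pair = id).
  by rewrite preimage_id product_measure1E// lte_mul_pinfty// ge0_fin_numE.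
by apply/funext => x /=; rewrite gK.
Qed.

HB.instance Definition _ := Measure_isSigmaFinite.Build _ _ _ tuple_step
  tuple_step_sigma_finite.

End tuple_measure.

Fixpoint lebesgue_tuple (R : realType) (n : nat) :
    {sigma_finite_measure set (n.-tuple (measurableTypeR R)) -> \bar R} :=
  match n with
  | 0 => \d_([tuple] : 0.-tuple (measurableTypeR R))
  | m.+1 => tuple_step (lebesgue_tuple R m)
  end.

Section lebesgue_rV.
Context (R : realType) (l : nat).

Definition rV_of_tuple (t : l.-tuple (measurableTypeR R)) : 'rV[R]_l :=
  \row_i tnth t i.

Definition lebesgue_rV (A : set 'rV[R]_l) : \bar R :=
  ((lebesgue_tuple R l)^*)%mu (rV_of_tuple @^-1` A).

Let lebesgue_rV0 : lebesgue_rV set0 = 0%E.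
Proof. by rewrite /lebesgue_rV preimage_set0 outer_measure0. Qed.

Let lebesgue_rV_ge0 A : (0 <= lebesgue_rV A)%E.
Proof. exact: outer_measure_ge0. Qed.

Let le_lebesgue_rV : {homo lebesgue_rV : A B / A `<=` B >-> (A <= B)%E}.
Proof. by move=> A B AB; apply: le_outer_measure => t /=; exact: AB. Qed.

Let lebesgue_rV_subadditive : sigma_subadditive lebesgue_rV.
Proof.
move=> F; rewrite /lebesgue_rV preimage_bigcup.
exact: outer_measure_sigma_subadditive.
Qed.

HB.instance Definition _ := isOuterMeasure.Build R 'rV[R]_l lebesgue_rV
  lebesgue_rV0 lebesgue_rV_ge0 le_lebesgue_rV lebesgue_rV_subadditive.

End lebesgue_rV.

Definition lebesgue_outer (R : realType) (l : nat) :
  {outer_measure set 'rV[R]_l -> \bar R} := @lebesgue_rV R l.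

(** The points of [R^l], with the sigma-algebra of Lebesgue measurable sets. *)
Definition Leb_space (R : realType) (l : nat) :=
  caratheodory_type (lebesgue_outer R l).
HB.instance Definition _ R l := Measurable.on (Leb_space R l).

Definition Leb (R : realType) (l : nat) :
    {measure set (Leb_space R l) -> \bar R} :=
  lebesgue_outer R l : set (caratheodory_type (lebesgue_outer R l)) -> \bar R.

Section geometry.
Context (R : realType) (l : nat).
Local Notation V := 'rV[R]_l.
Implicit Types (A K L S Omega : set V) (x y n : V).

Definition dot x y : R := \sum_(i < l) x 0 i * y 0 i.

(** The library norm on ['rV_l] is the sup norm; the metric notions below are
    Euclidean. *)
Definition enorm x : R := Num.sqrt (dot x x).

Definition diam A : R := sup [set enorm (p.1 - p.2) | p in A `*` A].

Definition vol A : R := fine (lebesgue_rV A).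

Definition bdry A : set V := closure A `\` A^°.

Definition in_hyperplane S :=
  exists n : V, n != 0 /\ exists c : R, S `<=` [set x | dot n x = c].

Definition is_unit_normal S n :=
  enorm n = 1 /\ {in S &, forall x y, dot n (x - y) = 0}.

(** [(l-1)]-dimensional Lebesgue measure of a subset [S] of a hyperplane: the
    volume of the right prism [S + [0, 1] n] of height one over [S], [n] being
    a unit normal.  In an orthonormal frame whose last vector is [n] the prism
    is [S * [0, 1]].  The value does not depend on [n]: the unit normal is
    unique up to sign, unless [S] lies in an affine subspace of dimension less
    than [l-1], in which case every such prism is null.  For [l = 1] a point
    has measure one. *)
Definition prism n S : set V :=
  [set x + t *: n | x in S & t in `[0, 1]%classic].

Definition area S : R := vol (prism (xget 0 (is_unit_normal S)) S).

(** [Omega] is, near each of its boundary points, the strict hypograph of a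
    Lipschitz function in the direction [nu]; [gamma y] depends only on the
    projection of [y] on the hyperplane orthogonal to [nu]. *)
Definition lipschitz_boundary Omega :=
  forall x0, bdry Omega x0 ->
  exists (nu : V) (gamma : V -> R) (C r : R),
    [/\ enorm nu = 1, 0 < r,
        forall y z, `|gamma y - gamma z| <=
          C * enorm ((y - z) - dot nu (y - z) *: nu) &
        forall y, enorm (y - x0) < r -> (Omega y <-> dot nu y < gamma y)].

(** A (not necessarily convex) open polyhedron: the interior of a finite union
    of finite intersections of closed half-spaces [dot h.1 x <= h.2]. *)
Definition polyhedral K :=
  exists P : seq (seq (V * R)),
    K = [set x | exists2 hs, hs \in P &
                 forall h, h \in hs -> dot h.1 x <= h.2]^°.

End geometry.

Section data.
Context (R : realType) (l : nat).
Local Notation V := 'rV[R]_l.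

(** [phi] is defined on the whole line: it stands for the continuous
    nondecreasing extension used by the scheme. *)
Record problem_data (Omega : set V) (T umax uc : R) (f : R -> V)
    (phi : R -> R) (u0 : V -> R) : Prop := ProblemData {
  pb_open : open Omega ;
  pb_bounded : bounded_set Omega ;
  pb_lipschitz : lipschitz_boundary Omega ;
  pb_T : 0 < T ;
  pb_umax : 0 < umax ;
  pb_f_continuous : {within `[0, umax], continuous f} ;
  pb_f0 : f 0 = 0 ;
  pb_fumax : f umax = 0 ;
  pb_phi_continuous : continuous phi ;
  pb_phi_nondecreasing : {homo phi : x y / x <= y} ;
  pb_phi_lipschitz : [lipschitz phi x | x in `[0, umax]] ;
  pb_uc : 0 <= uc <= umax ;
  pb_phi_degenerate : {in `[0, uc], forall x, phi x = 0} ;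
  pb_phi_increasing : {in `[uc, umax] &, {homo phi : x y / x < y}} ;
  pb_nondegenerate : forall (xi : V) (a b : R),
    xi != 0 -> 0 <= a -> a < b -> b <= uc ->
    ~ (exists c d : R, {in `[a, b], forall s, dot xi (f s) = c * s + d}) ;
  pb_u0_measurable : measurable_fun (Omega : set (Leb_space R l)) u0 ;
  pb_u0_range : forall x, Omega x -> 0 <= u0 x <= umax
}.

(** Control volumes and edges are sets of points.  [edges K] is the set of all
    edges of [K], [normal K s] the unit normal to [s] outward to [K] and
    [center K] the point [x_K]. *)
Record mesh := Mesh {
  cells : {fset (set V)} ;
  edges : set V -> {fset (set V)} ;
  normal : set V -> set V -> V ;
  center : set V -> V
}.

Definition interface (K L : set V) : set V := closure K `&` closure L.

Definition neighbours (m : mesh) (K : set V) : {fset (set V)} :=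
  [fset L in cells m | (L != K) && (0 < area (interface K L))]%fset.

Definition ext_edges (Omega : set V) (m : mesh) (K : set V) : {fset (set V)} :=
  [fset s in edges m K | `[< (s `<=` bdry Omega)%classic >]]%fset.

Definition int_edges (Omega : set V) (m : mesh) (K : set V) : {fset (set V)} :=
  (edges m K `\` ext_edges Omega m K)%fset.

(** The cell [L] with [s = K|L]. *)
Definition across (m : mesh) (K s : set V) : set V :=
  xget K [set L | L \in neighbours m K /\ s = interface K L].

Definition mesh_size (m : mesh) : R :=
  sup [set diam K | K in [set K | K \in cells m]].

(** [n] points out of [K] at almost every point of [s]. *)
Definition outward (K s : set V) (n : V) :=
  area [set x | s x /\ ~ exists2 e : R, 0 < e &
          forall t, 0 < t < e -> K (x - t *: n) /\ ~ K (x + t *: n)] = 0.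

Record is_mesh (Omega : set V) (m : mesh) : Prop := IsMesh {
  mesh_polyhedral : {in cells m, forall K, polyhedral K} ;
  mesh_connected : {in cells m, forall K, connected K} ;
  mesh_sub : {in cells m, forall K, K `<=` Omega} ;
  mesh_disjoint : {in cells m &, forall K L, K != L -> K `&` L = set0} ;
  mesh_cover :
    \bigcup_(K in [set K | K \in cells m]) closure K = closure Omega ;
  mesh_interface :
    {in cells m &, forall K L, K != L -> in_hyperplane (interface K L)} ;
  mesh_edge_closed :
    {in cells m, forall K, {in edges m K, forall s, closed s}} ;
  mesh_edge_area :
    {in cells m, forall K, {in edges m K, forall s, 0 < area s}} ;
  mesh_edge_cover : {in cells m, forall K,
    \bigcup_(s in [set s | s \in edges m K]) s = bdry K} ;
  mesh_edge_overlap : {in cells m, forall K, {in edges m K &, forall s s',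
    s != s' -> area (s `&` s') = 0}} ;
  mesh_int_edges : {in cells m, forall K,
    int_edges Omega m K = [fset interface K L | L in neighbours m K]%fset} ;
  mesh_normal : {in cells m, forall K, {in edges m K, forall s,
    is_unit_normal s (normal m K s) /\ outward K s (normal m K s)}}
}.

Definition regular_mesh (alpha : R) (m : mesh) :=
  {in cells m, forall K,
    alpha * mesh_size m ^+ l <= vol K /\
    \sum_(s <- edges m K) area s <= alpha^-1 * mesh_size m ^+ l.-1}.

Definition admissible_mesh (m : mesh) :=
  {in cells m, forall K,
    K (center m K) /\
    {in neighbours m K, forall L, {in interface K L &, forall x y,
      dot (center m K - center m L) (x - y) = 0}}}.

Definition transmissibility (m : mesh) (K L : set V) : R :=
  area (interface K L) / enorm (center m K - center m L).

Record numerical_flux (m : mesh) (umax : R) (f : R -> V) (M : R)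
    (F : set V -> set V -> R -> R -> R) : Prop := NumericalFlux {
  flux_continuous : {in cells m, forall K, {in edges m K, forall s,
    continuous (fun p : R * R => F K s p.1 p.2)}} ;
  flux_monotone : {in cells m, forall K, {in edges m K, forall s,
    (forall b, {homo F K s ^~ b : a a' / a <= a'}) /\
    (forall a, {homo F K s a : b b' /~ b <= b'})}} ;
  flux_conservative : {in cells m, forall K, {in neighbours m K, forall L a b,
    F K (interface K L) a b = - F L (interface L K) b a}} ;
  flux_regular : {in cells m, forall K, {in edges m K, forall s,
    {in `[0, umax] & &, forall a a' b,
      `|F K s a b - F K s a' b| <= area s * M * `|a - a'| /\
      `|F K s b a - F K s b a'| <= area s * M * `|a - a'|}}} ;
  flux_consistent : {in cells m, forall K, {in edges m K, forall s,
    {in `[0, umax], forall c,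
      F K s c c = area s * dot (f c) (normal m K s)}}}
}.

Record scheme_solution (m : mesh) (F : set V -> set V -> R -> R -> R)
    (phi : R -> R) (u0 : V -> R) (dt : R) (u : nat -> set V -> R) : Prop :=
  SchemeSolution {
  scheme_init : {in cells m, forall K, u 0 K = (vol K)^-1 *
    \int[Leb R l]_(x in (K : set (Leb_space R l))) u0 x} ;
  scheme_step : forall n, {in cells m, forall K,
    vol K * ((u n.+1 K - u n K) / dt)
    + \sum_(L <- neighbours m K) F K (interface K L) (u n.+1 K) (u n.+1 L)
    - \sum_(L <- neighbours m K)
        transmissibility m K L * (phi (u n.+1 L) - phi (u n.+1 K)) = 0}
}.

End data.

Section entropies.
Context (R : realType).
Implicit Types (k s r a b : R) (G : R -> R -> R).

Definition eta_plus k s := Num.max s k - k.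
Definition eta_minus k s := k - Num.min s k.

Definition sign_plus r : R := if 0 < r then 1 else 0.
Definition sign_minus r : R := if r < 0 then -1 else 0.

Definition Phi_plus G k a b := G (Num.max a k) (Num.max b k) - G k k.
Definition Phi_minus G k a b := G k k - G (Num.min a k) (Num.min b k).

End entropies.

(* Main.v *)
Require Import Defs.
From mathcomp Require Import all_boot all_order all_algebra finmap.
From mathcomp Require Import all_classical all_reals all_analysis.
From mathcomp Require Import ring lra.

Set Implicit Arguments.
Unset Strict Implicit.
Unset Printing Implicit Defensive.

Import Order.TTheory GRing.Theory Num.Theory.
Import numFieldNormedType.Exports.

(** Let [a] and [b L] be the new values in [K] and in its neighbours. When
    [a <= k], every term of the left-hand side of the sub-entropy inequality is
    nonpositive, by monotonicity of the fluxes and of [phi]. When [k < a], these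
    terms are dominated by the terms of the scheme, up to the fluxes
    [F K (interface K L) k k] of the constant state [k]; what remains to show is
    that the latter add up to minus the flux of [f k] through the boundary edges
    of [K], that is,
    [\sum_(s <- edges m K) area s * dot (f k) (normal m K s) = 0]. The
    super-entropy inequality is symmetric ([discrete_sub_entropy],
    [discrete_super_entropy]).

    The geometric content is thus the divergence theorem for constant fields on
    a polyhedron whose boundary is cut into arbitrary closed flat pieces
    ([polyhedral_divergence]). It is obtained by translating [K] by a small
    vector [e]. Since [K] and its translate have the same volume, as much volume
    enters as leaves: [vol ((K + e) `\` K) = vol ((K - e) `\` K)]. The
    set [(K + e) `\` K] is covered, up to a null set, by the prisms
    [s + [0, 1] e] over the faces [s] with [0 <= dot (nu s) e]: a segment that
    leaves [K] does so through such a face at almost every exit point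
    ([exit_point]). Conversely, when [e] is short, the prisms over the points of
    these faces near which [K] is the half-space behind the face lie, up to null
    sets, in [(K + e) `\` K] and do not overlap. Comparing [e] with [- e] gives
    the balance of the two families of faces.

    Two facts on the measure support this. First, the prism over a compact flat
    set [S] in the direction [v] has volume [`|dot n v| * area S]
    ([vol_prism_area]); as [area] is defined through prisms, this only needs
    translation invariance: hyperplanes are null because disjoint translates
    accumulate ([vol_flat]), the volume is linear in the height ([vol_prismZ])
    and invariant under shears, by slicing ([vol_prism_shear_le]). Secondly, near
    almost every point of a flat set a polyhedron is determined by the two sides
    of that set ([polyhedral_locally_sided]), since the hyperplanes that cross
    the flat set transversally meet it in a set of zero area
    ([vol_prism_codim2]).

    The same local description shows that an interface of positive area belongs
    to one neighbour only, three disjoint polyhedra having no room on two sides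
    ([three_polyhedra_area0]); this turns sums over interfaces into sums over
    neighbours ([sum_int_edges]). *)

Local Open Scope classical_set_scope.
Local Open Scope ring_scope.

(** * Translation invariance of the product measure on tuples *)

Section tuple_translation.
Context (R : realType).
Local Notation Rm := (measurableTypeR R).

Lemma measurable_shift (a : R) : measurable_fun setT (fun x : Rm => x + a : Rm).
Proof. by apply: measurable_realfun.measurable_funD. Qed.

Lemma lebesgue_measure_shift (a : R) (A : set Rm) : measurable A ->
  lebesgue_measure ((fun x : Rm => x + a) @^-1` A) = lebesgue_measure A.
Proof.
move=> mA; apply/esym.
have mf := measurable_shift a; pose f (x : Rm) : Rm := x + a.
rewrite -/(f) -/(pushforward lebesgue_measure f A).
apply: lebesgue_measure_unique => // X [[b c] _ <-].
transitivity (lebesgue_measure (f @^-1` `]b, c])); last by [].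
have -> : f @^-1` `]b, c] = `]b - a, c - a]%classic.
  by apply/seteqP; split => x /=; rewrite !in_itv/= ltrBlDr lerBrDr.
by rewrite !lebesgue_measure_itv/= !lte_fin ltrD2r -!EFinD opprB addrA subrK.
Qed.

Definition shift_tuple n (a t : n.-tuple Rm) : n.-tuple Rm :=
  [tuple tnth t i + tnth a i | i < n].

Lemma measurable_shift_tuple n (a : n.-tuple Rm) :
  measurable_fun setT (shift_tuple a).
Proof.
apply/measurable_fun_tnthP => i.
rewrite (_ : _ \o _ = (fun x : Rm => x + tnth a i : Rm) \o (@tnth n Rm ^~ i)).
  apply: measurableT_comp; first exact: measurable_shift.
  exact: measurable_tnth.
by apply/funext => t /=; rewrite tnth_mktuple.
Qed.

Lemma lebesgue_tuple_shift n (a : n.-tuple Rm) (A : set (n.-tuple Rm)) :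
  measurable A ->
  lebesgue_tuple R n (shift_tuple a @^-1` A) = lebesgue_tuple R n A.
Proof.
elim: n a A => [|n IH] a A mA.
  rewrite (_ : shift_tuple a = id) ?preimage_id//.
  by apply/funext => t; rewrite [t]tuple0 [LHS]tuple0.
pose b : n.-tuple Rm := [tuple of behead a].
pose g (p : Rm * n.-tuple Rm) : Rm * n.-tuple Rm :=
  (p.1 + thead a, shift_tuple b p.2).
have mg : measurable_fun setT g.
  apply/measurable_fun_pairP; split.
    by apply: measurableT_comp (measurable_shift _) _; exact: measurable_fst.
  by apply: measurableT_comp (measurable_shift_tuple _) _; exact: measurable_snd.
have gE : shift_tuple a \o @cons_pair R n = @cons_pair R n \o g.
  apply/funext => -[x t]; apply: eq_from_tnth => i /=.
  rewrite tnth_mktuple; case: (unliftP ord0 i) => [j|] ->.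
    by rewrite [in LHS](tuple_eta a) !tnthS/= tnth_mktuple.
  by rewrite [in LHS](tuple_eta a) !tnth0.
rewrite /= /tuple_step /pushforward -comp_preimage gE comp_preimage.
set B := _ @^-1` A.
have mB : measurable B.
  by rewrite /B -[X in measurable X]setTI; exact: measurable_cons_pair.
apply/esym; rewrite -/(pushforward _ g B).
apply: product_measure_unique => // C D mC mD.
rewrite [LHS](_ : _ = (@lebesgue_measure R \x lebesgue_tuple R n)%E
    (g @^-1` (C `*` D)))//.
rewrite (_ : g @^-1` (C `*` D) =
  ((fun x : Rm => x + thead a) @^-1` C) `*` (shift_tuple b @^-1` D))//.
rewrite product_measure1E.
- by congr (_ * _)%E; [exact: lebesgue_measure_shift|exact: IH].
- by rewrite -[X in measurable X]setTI; exact: measurable_shift.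
- by rewrite -[X in measurable X]setTI; exact: measurable_shift_tuple.
Qed.

Lemma mu_ext_tuple_shift n (a : n.-tuple Rm) (A : set (n.-tuple Rm)) :
  ((lebesgue_tuple R n)^*%mu (shift_tuple a @^-1` A) <=
   (lebesgue_tuple R n)^*%mu A)%E.
Proof.
apply: le_ereal_inf_tmp => _ [F [mF AF] <-].
apply: ereal_inf_lbound; exists (fun k => shift_tuple a @^-1` F k).
  split=> [k|].
    by rewrite -[X in measurable X]setTI; exact: measurable_shift_tuple.
  by move=> t /AF[k _ Fk]; exists k.
by apply: eq_eseriesr => k _; rewrite lebesgue_tuple_shift.
Qed.

Lemma measurable_tuple_box n (C : 'I_n -> set Rm) :
  (forall i, measurable (C i)) ->
  measurable [set t : n.-tuple Rm | forall i, C i (tnth t i)].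
Proof.
move=> mC; rewrite (_ : mkset _ = \bigcap_(i in setT) ((@tnth n Rm ^~ i) @^-1` C i)).
  apply: fin_bigcap_measurable => // i _; rewrite -[X in measurable X]setTI.
  exact: measurable_tnth.
by apply/seteqP; split => t /= H i; [move=> _; exact: H|exact: H].
Qed.

Lemma lebesgue_tuple_box n (r : R) : 0 <= r ->
  lebesgue_tuple R n [set t | forall i, tnth t i \in `[- r, r]] = ((r + r) ^+ n)%:E.
Proof.
move=> r0; elim: n => [|n IH].
  rewrite expr0 /= diracE (_ : _ \in _ = true)//.
  by apply/mem_set => -[].
rewrite /= /tuple_step /pushforward.
rewrite (_ : _ @^-1` _ =
  `[- r, r]%classic `*` [set t | forall i, tnth t i \in `[- r, r]]); last first.
  apply/seteqP; split => [[x t] /= H|[x t] [/= Hx Ht] i].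
    split=> [|i]; first by have /= := H ord0; rewrite tnth0.
    by have := H (lift ord0 i); rewrite tnthS.
  by case: (unliftP ord0 i) => [j|] ->; rewrite ?tnthS ?tnth0.
rewrite product_measure1E//.
- rewrite [LHS](_ : _ = lebesgue_measure (`[(- r)%R, r]%classic : set R) *
    ((r + r) ^+ n)%:E)%E; last by congr (_ * _)%E.
  rewrite lebesgue_measure_itv/= lte_fin.
  case: ltP => [_|rr]; first by rewrite -EFinD opprK -EFinM exprS.
  have -> : r = 0 by lra.
  by rewrite addr0 exprS mul0r mul0e.
- exact: (@measurable_tuple_box n (fun=> `[- r, r]%classic)).
Qed.

End tuple_translation.

(** * Lebesgue measure on row vectors *)

Section lebesgue_rV_theory.
Context (R : realType) (l : nat).
Local Notation V := 'rV[R]_l.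
Local Notation Rm := (measurableTypeR R).
Local Notation lam := (@lebesgue_rV R l).
Implicit Types (A B : set V) (v x : V).

Definition translate v A : set V := [set x | A (x - v)].

Lemma lebesgue_rV_translate_le v A : (lam (translate v A) <= lam A)%E.
Proof.
rewrite /lebesgue_rV; set B := _ @^-1` A.
rewrite (_ : _ @^-1` translate v A =
    shift_tuple [tuple (- v) 0 i | i < l] @^-1` B); first exact: mu_ext_tuple_shift.
apply/seteqP; split => t; rewrite /B/= /translate/=;
  rewrite (_ : rV_of_tuple (shift_tuple _ t) = rV_of_tuple t - v)//;
  by apply/rowP => i; rewrite !mxE tnth_mktuple tnth_mktuple mxE.
Qed.

Lemma translateK v A : translate (- v) (translate v A) = A.
Proof. by apply/seteqP; split => x; rewrite /translate/= opprK addrK. Qed.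

Lemma lebesgue_rV_translate v A : lam (translate v A) = lam A.
Proof.
apply/eqP; rewrite eq_le lebesgue_rV_translate_le/=.
by rewrite -{1}(translateK v A) lebesgue_rV_translate_le.
Qed.

Lemma measurable_rV_of_tuple A :
  measurable (@rV_of_tuple R l @^-1` A) -> measurable (A : set (Leb_space R l)).
Proof.
move=> mA; suff : (lebesgue_outer R l).-caratheodory A by [].
by move=> X; exact: (@caratheodory_measurable_mu_ext _ _ _ (lebesgue_tuple R l) _ mA).
Qed.

Lemma tnth_rV_of_tuple (t : l.-tuple Rm) i : rV_of_tuple t 0 i = tnth t i.
Proof. by rewrite mxE. Qed.

(** An open set is the union of the balls with rational centres and radii
    [1 / N] that it contains, and these balls are boxes. *)
Lemma open_measurable_rV A : open A -> measurable (A : set (Leb_space R l)).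
Proof.
move=> oA; apply: measurable_rV_of_tuple.
pose q (p : 'rV[rat]_l * nat) : V := map_mx ratr p.1.
pose F (p : 'rV[rat]_l * nat) : set V :=
  if `[< ball (q p) p.2.+1%:R^-1 `<=` A >] then ball (q p) p.2.+1%:R^-1 else set0.
have -> : A = \bigcup_p F p.
  apply/seteqP; split => [x Ax|x [p _]]; last first.
    by rewrite /F; case: ifPn => // /asboolP; apply.
  have /nbhs_ballP[_/posnumP[e] eA] : nbhs x A by exact: open_nbhs_nbhs.
  have [N N0 HN] : exists2 N : nat, true & N.+1%:R^-1 < e%:num / 2 :> R.
    have e20 : 0 < e%:num / 2 :> R by rewrite divr_gt0.
    by have [N _ /(_ N (leqnn _))] := near_infty_natSinv_lt (PosNum e20); exists N.
  have d0 : 0 < N.+1%:R^-1 :> R by rewrite invr_gt0.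
  have Q i : exists r : rat, ratr r \in `]x 0 i - N.+1%:R^-1, x 0 i + N.+1%:R^-1[.
    by apply: rat_in_itvoo; rewrite ltrD2l gtrN.
  pose r := \row_i projT1 (cid (Q i)).
  have xr : ball (q (r, N)) N.+1%:R^-1 x.
    split=> // i j; rewrite (ord1 i) !mxE; case: cid => s /=.
    rewrite in_itv/= /ball/= => /andP[s1 s2].
    by rewrite ltr_norml ltrBlDl ltrBrDl s2 s1.
  exists (r, N) => //; rewrite /F; case: ifPn => // /asboolP; case.
  move=> y /= ry; apply: eA; rewrite (splitr e%:num).
  apply: ball_triangle; last exact: (le_ball (ltW HN) ry).
  by apply: (le_ball (ltW HN)); exact: ball_sym.
rewrite preimage_bigcup; apply: countable_bigcupT_measurable => // p.
rewrite /F; case: ifPn => _; last by rewrite preimage_set0.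
rewrite (_ : _ @^-1` _ =
    [set t : l.-tuple Rm | forall i, ball (q p 0 i) p.2.+1%:R^-1 (tnth t i)]).
  by apply: (@measurable_tuple_box R l (fun i => ball (q p 0 i) p.2.+1%:R^-1)) => i;
    exact: measurable_realfun.measurable_ball.
apply/seteqP; split => t /= H.
  by move=> i; rewrite -tnth_rV_of_tuple; case: H => _; exact.
by split=> [|i j]; rewrite ?invr_gt0// (ord1 i) tnth_rV_of_tuple.
Qed.

Lemma closed_measurable_rV A : closed A -> measurable (A : set (Leb_space R l)).
Proof.
by move=> cA; rewrite -[A]setCK; apply: measurableC; apply: open_measurable_rV;
  exact: closed_openC.
Qed.

Lemma bounded_rVP A : bounded_set A <-> exists M, forall x, A x -> `|x| <= M.
Proof.
split=> [[M [_ HM]]|[M HM]]; first by exists (M + 1); apply: HM; rewrite ltrDl.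
by exists M; split=> [|N MN x /HM /le_trans]; [exact: num_real|apply; exact: ltW].
Qed.

Lemma bounded_lebesgue_rV A : bounded_set A -> (lam A < +oo)%E.
Proof.
move=> /bounded_rVP[M HM].
pose r := `|M|; pose B := [set t : l.-tuple Rm | forall i, tnth t i \in `[- r, r]].
have mB : measurable B by exact: (@measurable_tuple_box R l (fun=> `[- r, r]%classic)).
apply: (@le_lt_trans _ _ (((lebesgue_tuple R l)^*)%mu B)).
  apply: le_mu_ext => t /= /HM H i; rewrite in_itv/= -ler_norml.
  rewrite -tnth_rV_of_tuple; apply: le_trans (le_trans H (ler_norm M)).
  by rewrite [leRHS]/Num.norm/= mx_normrE; apply/bigmax_geP; right; exists (0, i).
rewrite measurable_mu_extE// (@le_lt_trans _ _ ((r + r) ^+ l)%:E) ?ltry//.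
by rewrite le_eqVlt; apply/orP; left; apply/eqP; exact: (lebesgue_tuple_box l (normr_ge0 M)).
Qed.

End lebesgue_rV_theory.

(** * Volumes of bounded sets *)

Section vol_theory.
Context (R : realType) (l : nat).
Local Notation V := 'rV[R]_l.
Local Notation lam := (@lebesgue_rV R l).
Implicit Types (A B S : set V) (v x : V).

Lemma sub_bounded_set A B : A `<=` B -> bounded_set B -> bounded_set A.
Proof. by move=> AB /bounded_rVP[M HM]; apply/bounded_rVP; exists M => x /AB/HM. Qed.

Lemma bounded_setU2 A B : bounded_set A -> bounded_set B -> bounded_set (A `|` B).
Proof.
move=> /bounded_rVP[M HM] /bounded_rVP[N HN]; apply/bounded_rVP.
by exists (Num.max M N) => x [/HM|/HN] H; rewrite le_max H ?orbT.
Qed.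

Lemma bounded_translate v A : bounded_set A -> bounded_set (translate v A).
Proof.
move=> /bounded_rVP[M HM]; apply/bounded_rVP; exists (M + `|v|) => x /HM H.
by rewrite -[x](subrK v) (le_trans (ler_normD _ _))// lerD2r.
Qed.

Lemma fin_lebesgue_rV A : bounded_set A -> lam A \is a fin_num.
Proof. by move=> bA; rewrite ge0_fin_numE ?outer_measure_ge0 ?bounded_lebesgue_rV. Qed.

Lemma volK A : bounded_set A -> (vol A)%:E = lam A.
Proof. by move=> bA; rewrite /vol fineK ?fin_lebesgue_rV. Qed.

Lemma vol_ge0 A : 0 <= vol A.
Proof. by rewrite fine_ge0 ?outer_measure_ge0. Qed.

Lemma le_vol A B : bounded_set B -> A `<=` B -> vol A <= vol B.
Proof.
move=> bB AB; rewrite -lee_fin !volK//; last exact: sub_bounded_set bB.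
exact: le_outer_measure.
Qed.

Lemma vol_translate v A : vol (translate v A) = vol A.
Proof. by rewrite /vol lebesgue_rV_translate. Qed.

Lemma volU_le A B : bounded_set A -> bounded_set B ->
  vol (A `|` B) <= vol A + vol B.
Proof.
move=> bA bB; rewrite -lee_fin EFinD !volK//; last exact: bounded_setU2.
exact: outer_measureU2.
Qed.

Lemma vol0 : vol (set0 : set V) = 0.
Proof. by rewrite /vol outer_measure0. Qed.

Lemma volU_null A B : bounded_set A -> bounded_set B -> vol B = 0 ->
  vol (A `|` B) = vol A.
Proof.
move=> bA bB B0; apply/eqP; rewrite eq_le; apply/andP; split.
  by rewrite (le_trans (volU_le bA bB))// B0 addr0.
by apply: le_vol; [exact: bounded_setU2|exact: subsetUl].
Qed.

Lemma vol_additive A B : closed A -> bounded_set A -> bounded_set B ->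
  vol (A `&` B) = 0 -> vol (A `|` B) = vol A + vol B.
Proof.
move=> cA bA bB AB0; apply/eqP; rewrite eq_le volU_le//=.
have mA : (lebesgue_outer R l).-caratheodory A by exact: closed_measurable_rV.
have bD : bounded_set (B `&` ~` A) by apply: sub_bounded_set bB; exact: subIsetl.
have bI : bounded_set (A `&` B) by apply: sub_bounded_set bA; exact: subIsetl.
have -> : vol (A `|` B) = vol A + vol (B `&` ~` A).
  apply: EFin_inj; rewrite EFinD !volK//; last exact: bounded_setU2.
  rewrite [LHS]mA; congr (lam _ + lam _)%E.
    by rewrite setIC; apply/setIidPl; exact: subsetUl.
  by rewrite setIUl setICr set0U.
rewrite lerD2l -[leLHS](_ : vol ((B `&` ~` A) `|` (A `&` B)) = _).
  by rewrite volU_null.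
by congr vol; rewrite [A `&` B]setIC -setIUr setUC setUCr setIT.
Qed.

Lemma vol_bigcup0 (F : nat -> set V) A : (forall n, bounded_set (F n)) ->
  (forall n, vol (F n) = 0) -> A `<=` \bigcup_n F n -> vol A = 0.
Proof.
move=> bF F0 AF; suff : (lam A <= 0)%E.
  by move=> A0; rewrite /vol (_ : lam A = 0%E)//; apply/eqP;
    rewrite eq_le A0 outer_measure_ge0.
apply: (le_trans (le_outer_measure lam _ _ AF)).
apply: (le_trans (outer_measure_sigma_subadditive lam F)).
rewrite (eq_eseriesr (g := fun=> 0%E)) ?eseries0// => n _.
by have := volK (bF n); rewrite F0 => /esym.
Qed.

Lemma vol_bigcup_cvg (F : nat -> set V) : (forall n, closed (F n)) ->
  {homo F : n m / (n <= m)%N >-> n `<=` m} -> bounded_set (\bigcup_n F n) ->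
  vol (F n) @[n --> \oo] --> vol (\bigcup_n F n).
Proof.
move=> cF ndF bF; apply: fine_cvg; rewrite volK//.
apply: (@nondecreasing_cvg_mu _ _ _ (Leb R l)).
- by move=> n; exact: closed_measurable_rV.
- by apply: bigcupT_measurable => n; exact: closed_measurable_rV.
- by move=> n m /ndF/subsetPset.
Qed.

Lemma vol_bigcap_cvg (F : nat -> set V) : (forall n, closed (F n)) ->
  {homo F : n m / (n <= m)%N >-> m `<=` n} -> bounded_set (F 0%N) ->
  vol (F n) @[n --> \oo] --> vol (\bigcap_n F n).
Proof.
move=> cF ndF bF; apply: fine_cvg; rewrite volK//; last first.
  by apply: sub_bounded_set bF; exact: bigcap_inf.
apply: (@nonincreasing_cvg_mu _ _ _ (Leb R l)).
- exact: bounded_lebesgue_rV.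
- by move=> n; exact: closed_measurable_rV.
- by apply: bigcapT_measurable => n; exact: closed_measurable_rV.
- by move=> n m /ndF/subsetPset.
Qed.

Lemma bounded_bigsetU (I : eqType) (r : seq I) (F : I -> set V) :
  {in r, forall i, bounded_set (F i)} -> bounded_set [set x | exists2 i, i \in r & F i x].
Proof.
elim: r => [_|i r IH H].
  by apply/bounded_rVP; exists 0 => x [].
apply: (@sub_bounded_set _ (F i `|` [set x | exists2 i, i \in r & F i x])).
  move=> x /= [j]; rewrite in_cons => /predU1P[->|jr Fx]; first by left.
  by right; exists j.
apply: bounded_setU2; first by apply: H; rewrite mem_head.
by apply: IH => j jr; apply: H; rewrite in_cons jr orbT.
Qed.

Lemma vol_bigsetU_le (I : eqType) (r : seq I) (F : I -> set V) A :
  {in r, forall i, bounded_set (F i)} ->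
  A `<=` [set x | exists2 i, i \in r & F i x] -> vol A <= \sum_(i <- r) vol (F i).
Proof.
elim: r A => [A _ H|i r IH A H AF].
  by rewrite big_nil (_ : A = set0) ?vol0// -subset0 => x /H[].
rewrite big_cons.
have Hi : bounded_set (F i) by apply: H; rewrite mem_head.
have Hr : {in r, forall i, bounded_set (F i)}.
  by move=> j jr; apply: H; rewrite in_cons jr orbT.
have Hb := bounded_bigsetU Hr.
apply: (@le_trans _ _ (vol (F i `|` [set x | exists2 i, i \in r & F i x]))).
  apply: le_vol; first exact: bounded_setU2.
  move=> x /AF[j]; rewrite in_cons => /predU1P[->|jr Fx]; first by left.
  by right; exists j.
by apply: (le_trans (volU_le Hi Hb)); rewrite lerD2l; exact: IH.
Qed.

Lemma vol_bigsetU_null (I : eqType) (r : seq I) (F : I -> set V) A :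
  {in r, forall i, bounded_set (F i)} -> {in r, forall i, vol (F i) = 0} ->
  A `<=` [set x | exists2 i, i \in r & F i x] -> vol A = 0.
Proof.
move=> bF F0 AF; apply/eqP; rewrite eq_le vol_ge0 andbT.
by rewrite (le_trans (vol_bigsetU_le bF AF))// big_seq big1.
Qed.

Lemma sum_vol_disjoint (I : eqType) (r : seq I) (F : I -> set V) A :
  uniq r -> {in r, forall i, closed (F i)} -> bounded_set A ->
  {in r, forall i, F i `<=` A} ->
  {in r &, forall i j, i != j -> vol (F i `&` F j) = 0} ->
  \sum_(i <- r) vol (F i) <= vol A.
Proof.
move=> + + bA.
suff H : uniq r -> {in r, forall i, closed (F i)} ->
    {in r, forall i, F i `<=` A} ->
    {in r &, forall i j, i != j -> vol (F i `&` F j) = 0} ->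
    \sum_(i <- r) vol (F i) <= vol [set x | exists2 i, i \in r & F i x].
  move=> ur cF FA F0; apply: (le_trans (H ur cF FA F0)).
  by apply: le_vol => // x [i ir]; exact: FA.
elim: r => [_ _ _ _|i r IH /=/andP[ir ur] cF FA F0].
  by rewrite big_nil vol_ge0.
have sr j : j \in r -> j \in i :: r by rewrite in_cons orbC => ->.
rewrite big_cons.
have bFi j : j \in i :: r -> bounded_set (F j).
  by move=> jr; exact: sub_bounded_set (FA _ jr) bA.
have bFr := bounded_bigsetU bFi.
have bFs : bounded_set [set x | exists2 i, i \in r & F i x].
  by apply: sub_bounded_set bFr => x [j /sr]; exists j.
apply: (@le_trans _ _ (vol (F i) + vol [set x | exists2 i, i \in r & F i x])).
  rewrite lerD2l; apply: IH => //.
  - by move=> j /sr; exact: cF.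
  - by move=> j /sr; exact: FA.
  - by move=> j k /sr jr /sr; exact: F0.
have I0 : vol (F i `&` [set x | exists2 i, i \in r & F i x]) = 0.
  apply: (@vol_bigsetU_null _ r (fun j => F i `&` F j)).
  - by move=> j /sr jr; apply: sub_bounded_set (bFi _ jr); exact: subIsetr.
  - move=> j jr; apply: F0; rewrite ?mem_head ?sr//.
    by apply: contraNneq ir => ->.
  - by move=> x [Fx [j jr Fjx]]; exists j.
rewrite -(vol_additive (cF _ (mem_head _ _)) (bFi _ (mem_head _ _)) bFs I0).
apply: le_vol => // x [Fx|[j /sr jr Fx]]; last by exists j.
by exists i; rewrite ?mem_head.
Qed.

End vol_theory.

(** * Flat sets and prisms *)

Section prisms.
Context (R : realType) (l : nat).
Local Notation V := 'rV[R]_l.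
Implicit Types (A B S : set V) (n v w x y : V).

Lemma dotC x y : dot x y = dot y x.
Proof. by apply: eq_bigr => i _; rewrite mulrC. Qed.

Lemma dot0r n : dot n 0 = 0.
Proof. by rewrite /dot big1// => i _; rewrite mxE mulr0. Qed.

Lemma dotDr n x y : dot n (x + y) = dot n x + dot n y.
Proof. by rewrite /dot -big_split; apply: eq_bigr => i _; rewrite !mxE mulrDr. Qed.

Lemma dotZr n a x : dot n (a *: x) = a * dot n x.
Proof. by rewrite /dot mulr_sumr; apply: eq_bigr => i _; rewrite !mxE mulrCA. Qed.

Lemma dotNr n x : dot n (- x) = - dot n x.
Proof. by rewrite -scaleN1r dotZr mulN1r. Qed.

Lemma dotBr n x y : dot n (x - y) = dot n x - dot n y.
Proof. by rewrite dotDr dotNr. Qed.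

Lemma dot_ge0 x : 0 <= dot x x.
Proof. by apply: sumr_ge0 => i _; rewrite -expr2 sqr_ge0. Qed.

Lemma dot_eq0 x : (dot x x == 0) = (x == 0).
Proof.
apply/eqP/eqP => [/eqP|->]; last by rewrite dot0r.
rewrite psumr_eq0 => [/allP H|i _]; last by rewrite -expr2 sqr_ge0.
apply/rowP => i; have := H i (mem_index_enum _).
by rewrite -expr2 sqrf_eq0 mxE => /eqP.
Qed.

Lemma dot_unit n : enorm n = 1 -> dot n n = 1.
Proof.
by move=> n1; rewrite -(sqr_sqrtr (dot_ge0 n)) -/(enorm n) n1 expr1n.
Qed.

Lemma dot_bounded n : exists2 C, 0 < C & forall x, `|dot n x| <= C * `|x|.
Proof.
exists (1 + \sum_(i < l) `|n 0 i|).
  by rewrite ltr_pwDl// sumr_ge0.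
move=> x; rewrite mulrDl mul1r; apply: (@le_trans _ _ ((\sum_(i < l) `|n 0 i|) * `|x|)); last by rewrite lerDr.
rewrite /dot (le_trans (ler_norm_sum _ _ _))// mulr_suml ler_sum// => i _.
rewrite normrM ler_wpM2l//.
by rewrite [leRHS]/Num.norm/= mx_normrE; apply/bigmax_geP; right; exists (0, i).
Qed.

(** For row vectors [`|_|] is the sup norm. All the metric arguments below use
    it; the Euclidean structure enters through [dot] only. *)
Lemma closed_approx S : closed S <->
  forall x, (forall e : R, 0 < e -> exists2 x', S x' & `|x - x'| < e) -> S x.
Proof.
split=> [cS x H|H x clx].
  apply: cS => B /nbhs_ballP[e e0 eB]; have [x' Sx' xx'] := H _ e0.
  by exists x'; split=> //; apply: eB; rewrite -ball_normE.
apply: H => e e0; have [x' []] := clx (ball x e) (nbhsx_ballx _ _ e0).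
by rewrite -ball_normE => Sx' xx'; exists x'.
Qed.

Lemma closed_hyperplane n (c : R) : closed [set x | dot n x = c].
Proof.
apply/closed_approx => x Hx; have [C C0 HC] := dot_bounded n.
apply/eqP; rewrite -subr_eq0 -normr_le0; apply/ler_addgt0Pr => e e0.
have [x' <- xx'] := Hx (e / C) (divr_gt0 e0 C0).
by rewrite -dotBr (le_trans (HC _))// add0r mulrC -ler_pdivlMr// ltW.
Qed.

Lemma scale_small v (r : R) : 0 < r ->
  exists2 d, 0 < d & forall u : R, `|u| <= d -> `|u *: v| < r.
Proof.
move=> r0; have v0 : 0 < 1 + `|v| by rewrite ltr_pwDl.
exists (r / (1 + `|v|) / 2) => [|u ud]; first by rewrite !divr_gt0.
rewrite normrZ (@le_lt_trans _ _ (`|u| * (1 + `|v|)))//.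
  by rewrite ler_wpM2l// lerDr.
rewrite -ltr_pdivlMr// (le_lt_trans ud)// ltr_pdivrMr// ltr_pMr ?ltr1n//.
by rewrite divr_gt0.
Qed.

Lemma closed_translate v S : closed S -> closed (translate v S).
Proof.
move=> /closed_approx H; apply/closed_approx => x Hx; apply: H => e e0.
have [x' Sx' xx'] := Hx e e0; exists (x' - v) => //.
by rewrite opprB addrA subrK.
Qed.

(** Lying in a hyperplane normal to [n], without naming its level. *)
Definition flat n S := forall x y, S x -> S y -> dot n x = dot n y.

Lemma flat_ext n S : flat n S -> exists c, forall x, S x -> dot n x = c.
Proof.
move=> fS; have [[x0 Sx0]|S0] := pselect (exists x, S x).
  by exists (dot n x0) => x Sx; exact: fS.
by exists 0 => x Sx; case: S0; exists x.
Qed.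

(** Arbitrarily many parallel translates of a piece of hyperplane fit in one
    bounded set without meeting each other. *)
Lemma vol_flat n S : n != 0 -> flat n S -> bounded_set S -> vol S = 0.
Proof.
move=> n0 /flat_ext[c Sc] /bounded_rVP[M SM].
pose S' : set V := [set x | dot n x = c /\ `|x| <= M].
have cS' : closed S'.
  rewrite (_ : S' = [set x | dot n x = c] `&` [set x | `|x| <= M])//.
  apply: closedI; first exact: closed_hyperplane.
  apply/closed_approx => x Hx.
  apply/ler_addgt0Pr => e e0; have [x' x'M xx'] := Hx e e0.
  by rewrite -[x](subrK x') addrC (le_trans (ler_normD _ _))// lerD// ltW.
(* [S'] replaces [S] because it is closed, hence measurable. *)
have bS' : bounded_set S' by apply/bounded_rVP; exists M => x [].
suff S'0 : vol S' = 0.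
  by apply/eqP; rewrite eq_le vol_ge0 andbT -S'0 le_vol// => x Sx; split; auto.
pose B : set V := [set x | `|x| <= M + `|n|].
have bB : bounded_set B by apply/bounded_rVP; exists (M + `|n|).
have HN (N : nat) : N%:R * vol S' <= vol B.
  pose t (i : nat) : R := i%:R / N%:R.
  pose F i := translate (t i *: n) S'.
  have := @sum_vol_disjoint R l nat (iota 0 N) F B (iota_uniq _ _) _ bB.
  have -> : \sum_(i <- iota 0 N) vol (F i) = N%:R * vol S'.
    under eq_bigr do rewrite /F vol_translate.
    by rewrite big_const_seq count_predT size_iota iter_addr_0 mulr_natl.
  apply.
  - by move=> i _; exact: closed_translate.
  - move=> i; rewrite mem_iota add0n/= => iN x [_ xM]; rewrite /B/=.
    rewrite -[x](subrK (t i *: n)) (le_trans (ler_normD _ _))// lerD//.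
    have N0 : 0 < N%:R :> R by rewrite ltr0n; case: (N) iN.
    rewrite normrZ ler_piMl// /t ger0_norm ?divr_ge0//.
    by rewrite ler_pdivrMr// mul1r ler_nat ltnW.
  - move=> i j; rewrite !mem_iota !add0n/= => iN _ ij.
    have N0 : N%:R != 0 :> R by rewrite pnatr_eq0; case: (N) iN.
    rewrite (_ : _ `&` _ = set0) ?vol0// -subset0 => x [[xi _] [xj _]].
    move: xi; rewrite -xj !dotBr !dotZr => /(addrI)/oppr_inj.
    move=> /(mulIf _); rewrite dot_eq0 => /(_ n0) /(mulIf _).
    rewrite invr_eq0 => /(_ N0)/eqP; rewrite eqr_nat => /eqP ijE.
    by rewrite ijE eqxx in ij.
apply/eqP; rewrite eq_le vol_ge0 andbT leNgt; apply/negP => S'0.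
have [N] : exists N : nat, vol B / vol S' < N%:R.
  exists (Num.trunc (vol B / vol S')).+1.
  by have /andP[] := truncn_itv (divr_ge0 (vol_ge0 B) (ltW S'0)).
by rewrite ltr_pdivrMr// ltNge HN.
Qed.

Lemma prismP v S y : prism v S y <->
  exists x t, [/\ S x, 0 <= t <= 1 & y = x + t *: v].
Proof.
split=> [[x Sx [t t01 <-]]|[x [t [Sx t01 ->]]]].
  by exists x, t; split=> //; move: t01; rewrite /= in_itv.
by exists x => //; exists t => //; rewrite /= in_itv.
Qed.

Lemma sub_prism v A B : A `<=` B -> prism v A `<=` prism v B.
Proof. by move=> AB y /prismP[x [t [/AB Bx t01 ->]]]; apply/prismP; exists x, t. Qed.

Lemma compact_prism v S : compact S -> compact (prism v S).
Proof.
move=> cS; pose f (p : V * R) : V := p.1 + p.2 *: v.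
have -> : prism v S = f @` (S `*` `[0, 1]%classic).
  apply/seteqP; split => [y [x Sx [t t01 <-]]|y [[x t] [/= Sx t01] <-]].
    by exists (x, t).
  by exists x => //; exists t.
apply: continuous_compact; last by apply: compact_setX => //; exact: segment_compact.
apply: continuous_subspaceT => p; apply: cvgD; first exact: cvg_fst.
by apply: cvgZr_tmp; exact: cvg_snd.
Qed.

Lemma compact_closed_rV S : compact S -> closed S.
Proof. by apply: compact_closed; exact: norm_hausdorff. Qed.

Lemma bounded_prism v S : bounded_set S -> bounded_set (prism v S).
Proof.
move=> /bounded_rVP[M HM]; apply/bounded_rVP; exists (M + `|v|).
move=> y /prismP[x [t [Sx /andP[t0 t1] ->]]].
rewrite (le_trans (ler_normD _ _))// lerD ?HM// normrZ ger0_norm//.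
by rewrite ler_piMl.
Qed.

Lemma flat_prism n v S : flat n S -> dot n v = 0 -> flat n (prism v S).
Proof.
move=> fS nv y y' /prismP[x [t [Sx _ ->]]] /prismP[x' [t' [Sx' _ ->]]].
by rewrite !dotDr !dotZr nv !mulr0 !addr0; exact: fS.
Qed.

Lemma prismN v S : prism (- v) S = translate (- v) (prism v S).
Proof.
apply/seteqP; split=> y.
  move=> /prismP[x [t [Sx t01 ->]]]; rewrite /translate/= opprK.
  apply/prismP; exists x, (1 - t); split=> //; first by lra.
  by rewrite scalerBl scale1r scalerN addrAC addrA.
move=> /prismP[x [t [Sx t01]]]; rewrite opprK => /(canRL (addrK v)) ->.
apply/prismP; exists x, (1 - t); split=> //; first by lra.
by rewrite scalerBl scale1r scalerN opprK [- v + _]addrC addrA.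
Qed.

End prisms.

(** * The volume of a prism *)

Section prism_volume.
Context (R : realType) (l : nat).
Local Notation V := 'rV[R]_l.
Implicit Types (A B S : set V) (n v w x y : V).

Lemma prismZP t v S y : 0 <= t -> prism (t *: v) S y <->
  exists x u, [/\ S x, 0 <= u <= t & y = x + u *: v].
Proof.
move=> t0; split=> [/prismP[x [a [Sx /andP[a0 a1] ->]]]|[x [u [Sx /andP[u0 ut] ->]]]].
  exists x, (a * t); split; rewrite ?scalerA//.
  by rewrite mulr_ge0//= ler_piMl.
apply/prismP; have [t_eq0|tn0] := eqVneq t 0.
  have {}u0 : u = 0 by apply/eqP; rewrite eq_le u0 -t_eq0 ut.
  by exists x, 0; split; rewrite ?lexx ?ler01// u0 !scale0r.
have tp : 0 < t by rewrite lt_neqAle eq_sym tn0.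
exists x, (u / t); split; rewrite ?scalerA ?divfK//.
by rewrite divr_ge0//= ler_pdivrMr// mul1r.
Qed.

(** Two stacked prisms meet in a set that is flat for [n]. *)
Lemma vol_prismD n v S (s t : R) : compact S -> flat n S -> dot n v != 0 ->
  0 <= s -> 0 <= t ->
  vol (prism ((s + t) *: v) S) = vol (prism (s *: v) S) + vol (prism (t *: v) S).
Proof.
move=> cS fS nv s0 t0.
have bS := compact_bounded cS.
have -> : prism ((s + t) *: v) S =
    prism (s *: v) S `|` translate (s *: v) (prism (t *: v) S).
  apply/seteqP; split => y.
    move=> /prismZP[|x [u [Sx /andP[u0 ust] ->]]]; first exact: addr_ge0.
    have [us|su] := leP u s; [left|right].
      by apply/prismZP => //; exists x, u; rewrite u0 us.
    apply/prismZP => //; exists x, (u - s).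
    by split; rewrite ?scalerBl ?addrA// subr_ge0 (ltW su)/= lerBlDl.
  move=> [/prismZP[]// x [u [Sx /andP[u0 us] ->]]|/prismZP[]// x [u [Sx /andP[u0 ut]]]].
    apply/prismZP; first exact: addr_ge0.
    by exists x, u; split; rewrite ?u0 ?(le_trans us)//= lerDl.
  move=> /(canRL (subrK _)) ->; apply/prismZP; first exact: addr_ge0.
  exists x, (s + u); rewrite addr_ge0//= lerD2l ut; split=> //.
  by rewrite -addrA -scalerDl addrC [u + s]addrC addrC.
rewrite vol_additive ?vol_translate//.
- by apply: compact_closed_rV; exact: compact_prism.
- exact: bounded_prism.
- by apply: bounded_translate; exact: bounded_prism.
apply: (@vol_flat _ _ n).
- by apply: contraNneq nv => ->; rewrite dotC dot0r.
- have [c Sc] := flat_ext fS.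
  suff H y : prism (s *: v) S y -> translate (s *: v) (prism (t *: v) S) y ->
      dot n y = c + s * dot n v.
    by move=> y y' [? ?] [? ?]; rewrite (H y)// (H y').
  move=> /prismZP[]// x [u [Sx /andP[u0 us] ->]].
  move=> /prismZP[]// x' [u' [Sx' /andP[u0' ut']]].
  move=> /(congr1 (dot n)).
  rewrite !(dotBr, dotDr) !dotZr (Sc _ Sx) (Sc _ Sx') -addrA -mulrBl.
  move=> /addrI/(mulIf nv) usu'; congr (_ + _ * _).
  by apply/eqP; rewrite eq_le us -subr_ge0 usu' u0'.
- by apply: (sub_bounded_set (@subIsetl _ _ _)); exact: bounded_prism.
Qed.

(** An additive nonnegative function is monotone, so that [N * g t] lies between
    [k * g 1] and [k.+1 * g 1] for [k] the integer part of [N * t]. *)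
Lemma additive_ge0_linear (g : R -> R) : (forall t, 0 <= t -> 0 <= g t) ->
  (forall s t, 0 <= s -> 0 <= t -> g (s + t) = g s + g t) ->
  forall t, 0 <= t -> g t = t * g 1.
Proof.
move=> g0 gD t t0.
have gN (N : nat) s : 0 <= s -> g (N%:R * s) = N%:R * g s.
  move=> s0; elim: N => [|N IH].
    rewrite !mul0r; apply: (addIr (g 0)); rewrite add0r -gD// addr0//.
  by rewrite -!natr1 !mulrDl !mul1r gD ?IH// mulr_ge0.
have gle s s' : 0 <= s -> s <= s' -> g s <= g s'.
  by move=> s0 ss'; rewrite -[s'](subrK s) addrC gD ?lerDl ?g0 ?subr_ge0.
have g1 := g0 _ ler01.
have H (N : nat) : N%:R * `|g t - t * g 1| <= g 1.
  have Nt0 : 0 <= N%:R * t by rewrite mulr_ge0.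
  have /andP[k1 k2] := truncn_itv Nt0; set k := Num.trunc _ in k1 k2.
  have H1 : k%:R * g 1 <= N%:R * g t by rewrite -!gN// mulr1; apply: gle.
  have H2 : N%:R * g t <= k.+1%:R * g 1.
    by rewrite -!gN// mulr1; apply: gle => //; exact: ltW.
  have H3 : k%:R * g 1 <= N%:R * t * g 1 by rewrite ler_wpM2r.
  have H4 : N%:R * t * g 1 <= k.+1%:R * g 1 by rewrite ler_wpM2r// ltW.
  rewrite -[N%:R]ger0_norm// -normrM ler_norml mulrBr mulrA.
  move: H2 H4; rewrite -natr1 mulrDl mul1r => H2 H4; apply/andP; lra.
apply/eqP; rewrite -subr_eq0 -normr_eq0 eq_le normr_ge0 andbT leNgt.
apply/negP => d0.
have := H (Num.trunc (g 1 / `|g t - t * g 1|)).+1.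
rewrite leNgt -ltr_pdivrMr//.
by have /andP[_ ->] := truncn_itv (divr_ge0 g1 (ltW d0)).
Qed.

Lemma vol_prismZ n v S (t : R) : compact S -> flat n S -> dot n v != 0 ->
  0 <= t -> vol (prism (t *: v) S) = t * vol (prism v S).
Proof.
move=> cS fS nv t0.
rewrite (@additive_ge0_linear (fun t => vol (prism (t *: v) S))) ?scale1r//.
  by move=> *; exact: vol_ge0.
by move=> s' t' s0 t0'; exact: (vol_prismD cS fS nv).
Qed.

(** Slice the sheared prism into [N] layers and slide each of them parallel to
    [w]: they then fill a part of the prism in the direction [v] over the base
    thickened by [[0, 1 / N] w], and the thickened base shrinks to the base. *)
Lemma vol_prism_shear_le n v w S : compact S -> flat n S -> dot n v != 0 ->
  dot n w = 0 -> vol (prism (v + w) S) <= vol (prism v S).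
Proof.
move=> cS fS nv nw.
have bS := compact_bounded cS.
pose S_ (N : nat) := prism (N.+1%:R^-1 *: w) S.
have N1 (N : nat) : 0 < N.+1%:R^-1 :> R by rewrite invr_gt0.
have cS_ N : compact (S_ N) by exact: compact_prism.
have fS_ N : flat n (S_ N) by apply: flat_prism => //; rewrite dotZr nw mulr0.
have le_N N : vol (prism (v + w) S) <= vol (prism v (S_ N)).
  have -> : vol (prism v (S_ N)) =
      \sum_(i <- iota 0 N.+1) vol (translate ((i%:R / N.+1%:R) *: (v + w))
        (prism (N.+1%:R^-1 *: v) (S_ N))).
    under eq_bigr do rewrite vol_translate (vol_prismZ (cS_ N) (fS_ N) nv (ltW (N1 N))).
    rewrite big_const_seq count_predT size_iota iter_addr_0 -[RHS]mulr_natl mulrA.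
    by rewrite divff ?mul1r// pnatr_eq0.
  apply: vol_bigsetU_le => [i _|y].
    by apply: bounded_translate; apply: bounded_prism; exact: compact_bounded.
  move=> /prismP[x [t [Sx /andP[t0 t1] ->]]].
  have [i iN /andP[it ti]] : exists2 i : nat, (i < N.+1)%N &
      i%:R / N.+1%:R <= t <= i%:R / N.+1%:R + N.+1%:R^-1.
    have Nt0 : 0 <= N.+1%:R * t by rewrite mulr_ge0.
    have succ_frac (k : nat) : k%:R / N.+1%:R + N.+1%:R^-1 = k.+1%:R / N.+1%:R :> R.
      by rewrite -[k.+1%:R]natr1 mulrDl mul1r.
    have := truncn_itv Nt0; set k := Num.trunc _ => /andP[k1 k2].
    (* [t = 1] is the only value whose integer part overshoots the last layer. *)
    have [kN|kN] := leqP k N.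
      exists k => //; rewrite ler_pdivrMr// mulrC k1/=.
      by rewrite succ_frac ler_pdivlMr// mulrC ltW.
    exists N => //.
    rewrite succ_frac divff ?pnatr_eq0// t1 andbT.
    rewrite ler_pdivrMr// mulrC; apply: le_trans k1.
    by rewrite ler_nat ltnW.
  exists i; first by rewrite mem_iota.
  apply/prismZP; first exact: ltW.
  set a := i%:R / _ in it ti *; exists (x + (t - a) *: w), (t - a).
  have ta : 0 <= t - a <= N.+1%:R^-1 by rewrite subr_ge0 it/= lerBlDl.
  split=> //; first by apply/prismZP; [exact: ltW|exists x, (t - a)].
  by rewrite -[LHS]addrA -scalerBl -[RHS]addrA -scalerDr [w + v]addrC.
have capS : \bigcap_N (prism v (S_ N)) `<=` prism v S.
  move=> y Hy; have [c Sc] := flat_ext fS.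
  (* The height of [y] does not depend on the prism that contains it. *)
  pose t0 := (dot n y - c) / dot n v.
  have Hy' N : exists x u t, [/\ S x, 0 <= u <= N.+1%:R^-1, 0 <= t <= 1,
      y = x + u *: w + t *: v & t = t0].
    have [z [t' [Sz t'01 yE]]] := (prismP v (S_ N) y).1 (Hy N I).
    have [x [u [Sx uN zE]]] := (prismZP w S z (ltW (N1 N))).1 Sz.
    rewrite {}zE {z Sz} in yE.
    exists x, u, t'; split=> //; rewrite /t0 yE !dotDr !dotZr Sc// nw mulr0 addr0.
    by rewrite addrC addKr mulfK.
  have t001 : 0 <= t0 <= 1 by have [x [u [t' [_ _ ? _ <-]]]] := Hy' 0%N.
  apply/prismP; exists (y - t0 *: v), t0; split=> //; last by rewrite subrK.
  apply: (closed_approx S).1; first exact: compact_closed_rV.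
  move=> e e0; have d0 : 0 < e / (1 + `|w|) by rewrite divr_gt0// ltr_pwDl.
  have [N _ /(_ N (leqnn _)) HN] := near_infty_natSinv_lt (PosNum d0).
  have [x [u [t' [Sx /andP[u0 uN] _ -> <-]]]] := Hy' N; exists x => //.
  rewrite addrK addrC addKr normrZ ger0_norm//.
  apply: (@le_lt_trans _ _ (N.+1%:R^-1 * (1 + `|w|))).
    by rewrite ler_pM// lerDr.
  by rewrite -ltr_pdivlMr// ltr_pwDl.
have cvgN : vol (prism v (S_ N)) @[N --> \oo] --> vol (\bigcap_N prism v (S_ N)).
  apply: vol_bigcap_cvg.
  - by move=> N; apply: compact_closed_rV; exact: compact_prism.
  - move=> N M NM; apply: sub_prism => y /prismZP[|x [u [Sx /andP[u0 uM] ->]]].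
      exact: ltW.
    apply/prismZP; first exact: ltW.
    exists x, u; split; rewrite ?u0 ?(le_trans uM)//=.
    by rewrite lef_pV2 ?posrE// ler_nat.
  - by apply: bounded_prism; exact: compact_bounded.
apply: (@le_trans _ _ (vol (\bigcap_N prism v (S_ N)))).
  apply: (cvgr_to_ge cvgN); apply: nearW; exact: le_N.
by apply: le_vol => //; exact: bounded_prism.
Qed.

(** The component of [v] along [S] is a shear; what is left of [v] is its
    component [dot n v] along the normal. *)
Lemma vol_prism n v S : compact S -> flat n S -> dot n n = 1 ->
  vol (prism v S) = `|dot n v| * vol (prism n S).
Proof.
move=> cS fS n1; have bS := compact_bounded cS.
have [nv|nv] := eqVneq (dot n v) 0.
  rewrite nv normr0 mul0r (@vol_flat _ _ n)//.
  - by rewrite -dot_eq0 n1 oner_eq0.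
  - exact: flat_prism.
  - exact: bounded_prism.
set c := dot n v in nv *; pose w := v - c *: n.
have nw : dot n w = 0 by rewrite dotBr dotZr n1 mulr1 subrr.
have nc : dot n (c *: n) != 0 by rewrite dotZr n1 mulr1.
have -> : vol (prism v S) = vol (prism (c *: n) S).
  apply/eqP; rewrite eq_le; apply/andP; split.
    by rewrite -[v](subrK (c *: n)) addrC (vol_prism_shear_le cS fS).
  rewrite [X in prism X S](_ : _ = v + (- w)); last by rewrite opprB addrC subrK.
  by rewrite (vol_prism_shear_le cS fS)// dotNr nw oppr0.
have n10 : dot n n != 0 by rewrite n1 oner_eq0.
have [c0|c0] := leP 0 c; first by rewrite (vol_prismZ cS fS)// ger0_norm.
rewrite -[X in prism (X *: n)]opprK scaleNr prismN vol_translate.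
by rewrite (vol_prismZ cS fS) ?ltr0_norm// oppr_ge0 ltW.
Qed.

End prism_volume.

(** * Area and local structure of polyhedra *)

Section area_theory.
Context (R : realType) (l : nat).
Local Notation V := 'rV[R]_l.
Implicit Types (A B S K : set V) (n v w x y m : V).

Lemma unit_normal_flat S n : is_unit_normal S n -> flat n S.
Proof.
by move=> [_ nS] x y Sx Sy; apply/eqP; rewrite -subr_eq0 -dotBr nS// inE.
Qed.

Lemma unit_normal_unit S n : is_unit_normal S n -> dot n n = 1.
Proof. by move=> [n1 _]; exact: dot_unit. Qed.

Lemma sub_unit_normal A B n : A `<=` B -> is_unit_normal B n -> is_unit_normal A n.
Proof.
move=> AB [n1 nB]; split=> // x y /set_mem/AB Bx /set_mem/AB By.
by apply: nB; rewrite inE.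
Qed.

Lemma area_ge0 S : 0 <= area S.
Proof. exact: vol_ge0. Qed.

Lemma xget_unit_normal S n : is_unit_normal S n ->
  is_unit_normal S (xget 0 (is_unit_normal S)).
Proof. by move=> Sn; apply: xgetPex; exists n. Qed.

(** Both the given normal [n] and the one chosen by [area] compute the volume
    of every prism, so the two unit prisms have volumes [a = |c| * b] and
    [b = |c| * a], with [c] the product of the normals. *)
Lemma vol_prism_area n v S : compact S -> is_unit_normal S n ->
  vol (prism v S) = `|dot n v| * area S.
Proof.
move=> cS nS; have nS' := xget_unit_normal nS.
rewrite /area; set n' := xget _ _ in nS' *.
have H u := vol_prism u cS (unit_normal_flat nS) (unit_normal_unit nS).
have H' u := vol_prism u cS (unit_normal_flat nS') (unit_normal_unit nS').
rewrite H; congr (_ * _); have E := H n'; have := H' n; rewrite dotC E.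
set c := `|_|; set a := vol _ => aE.
have : (1 - c) * ((1 + c) * a) = 0.
  by rewrite (_ : _ * _ = a - c * (c * a)); [rewrite -aE subrr|ring].
move/eqP; rewrite mulf_eq0 => /orP[|].
  by rewrite subr_eq0 => /eqP <-; rewrite mul1r.
have c0 : 0 <= c by exact: normr_ge0.
by rewrite mulf_eq0 gt_eqF/= ?ltr_pwDl// => /eqP ->; rewrite mulr0.
Qed.

(** The vanishing of [area E] concerns the normal of [E] chosen by [area], which
    may differ from the one at hand. As [E] need not be measurable, the prism
    formula is applied to its compact subsets, for that chosen normal. *)
Lemma area0_sub_prism E n v S : area E = 0 -> bounded_set E -> is_unit_normal E n ->
  compact S -> S `<=` E -> vol (prism v S) = 0.
Proof.
move=> E0 bE nE cS SE; have nE' := xget_unit_normal nE.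
move: E0; rewrite /area; set n' := xget _ _ in nE' * => E0.
have nS := sub_unit_normal SE nE'.
rewrite (vol_prism _ cS (unit_normal_flat nS) (unit_normal_unit nS)).
suff -> : vol (prism n' S) = 0 by rewrite mulr0.
apply/eqP; rewrite eq_le vol_ge0 andbT -E0 le_vol//; first exact: bounded_prism.
exact: sub_prism.
Qed.

(** The component of [n] orthogonal to [m]: the hyperplanes normal to [n] and to
    [m] are parallel exactly when it vanishes. *)
Definition tangential m n : V := n - (dot n m / dot m m) *: m.

(** The prism over [S] in the direction [tangential m n] lies in a hyperplane
    normal to [m], although that direction is transverse to the hyperplane
    normal to [n] that contains [S]. *)
Lemma vol_prism_codim2 n m S v : is_unit_normal S n -> compact S -> m != 0 ->
  tangential m n != 0 -> flat m S -> vol (prism v S) = 0.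
Proof.
move=> nS cS m0 t0 fS; set t := tangential m n in t0.
have mt : dot m t = 0.
  by rewrite /t dotBr dotZr divfK ?dot_eq0// dotC subrr.
have nt : dot n t != 0.
  have -> : n = t + (dot n m / dot m m) *: m by rewrite subrK.
  by rewrite dotC dotDr dotZr [dot t m]dotC mt mulr0 addr0 dot_eq0.
have : vol (prism t S) = 0.
  apply: (vol_flat m0); first exact: flat_prism.
  by apply: bounded_prism; exact: compact_bounded.
move/eqP; rewrite (vol_prism_area _ cS nS) mulf_eq0 normr_eq0 (negPf nt)/= => /eqP aS.
by rewrite (vol_prism_area _ cS nS) aS mulr0.
Qed.

(** Off the hyperplane through [x] normal to [n], membership in [A] of the
    points at distance less than [r] of [x] depends only on their side. *)
Definition sided A n x (r : R) (a b : bool) := forall y, `|y - x| < r ->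
  (dot n (y - x) < 0 -> (A y <-> a)) /\ (0 < dot n (y - x) -> (A y <-> b)).

Definition locally_sided A n x := exists r a b, 0 < r /\ sided A n x r a b.

Lemma sub_sided A n x (r r' : R) a b : r' <= r -> sided A n x r a b ->
  sided A n x r' a b.
Proof. by move=> rr' H y yx; apply: H; exact: lt_le_trans rr'. Qed.

Lemma locally_sided2 (op : bool -> bool -> bool) A B C n x :
  (forall y (a b : bool), (A y <-> a) -> (B y <-> b) -> (C y <-> op a b)) ->
  locally_sided A n x -> locally_sided B n x -> locally_sided C n x.
Proof.
move=> opC [r [a [b [r0 H]]]] [s [c [d [s0 H']]]].
exists (Num.min r s), (op a c), (op b d); split; first by rewrite lt_min r0.
move=> y; rewrite lt_min => /andP[/H[Ha Hb] /H'[Hc Hd]].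
by split=> ny; apply: opC; auto.
Qed.

Lemma locally_sided_const (p : bool) n x : locally_sided [set _ | p] n x.
Proof. by exists 1, p, p; split. Qed.

Lemma dot_gt0_near n x y : 0 < dot n (y - x) ->
  exists2 e, 0 < e & forall z, `|z - y| < e -> 0 < dot n (z - x).
Proof.
move=> ny; have [C C0 HC] := dot_bounded n.
exists (dot n (y - x) / C); first by rewrite divr_gt0.
move=> z zy; rewrite -[z](subrK y) -addrA dotDr.
have := HC (z - y); rewrite ler_norml => /andP[H _].
have : C * `|z - y| < dot n (y - x) by rewrite mulrC -ltr_pdivlMr.
by move: (dot n (z - y)) (dot n (y - x)) H => p q; lra.
Qed.

Lemma locally_sided_interior A n x : locally_sided A n x -> locally_sided A^° n x.
Proof.
move=> [r [a [b [r0 H]]]]; exists r, a, b; split=> // y yx.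
have key m (c : bool) : (forall z, `|z - x| < r -> 0 < dot m (z - x) -> (A z <-> c)) ->
    0 < dot m (y - x) -> (A^° y <-> c).
  move=> Hm my; split=> [/interior_subset|c1]; first by move/Hm; exact.
  have [e e0 He] := dot_gt0_near my.
  apply/nbhs_ballP; exists (Num.min e (r - `|y - x|)).
    by rewrite /= lt_min e0 subr_gt0.
  move=> z; rewrite -ball_normE/= distrC lt_min => /andP[ze zr].
  apply/Hm => //; last exact: He.
  by rewrite -[z](subrK y) -addrA (le_lt_trans (ler_normD _ _))// -ltrBrDr.
split=> ny; last by apply: (key n) => // z /H[].
apply: (key (- n)).
  by move=> z /H[+ _] nz; apply; rewrite dotC dotNr dotC oppr_gt0 in nz.
by rewrite dotC dotNr dotC oppr_gt0.
Qed.

(** Away from its boundary a half-space is locally everything or nothing; on a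
    boundary parallel to the hyperplanes normal to [n] it is one of the sides. *)
Lemma halfspace_locally_sided (h : V * R) n x :
  [/\ h.1 != 0, tangential h.1 n != 0 & dot h.1 x = h.2] \/
  locally_sided [set y | dot h.1 y <= h.2] n x.
Proof.
case: h => m c /=.
have [mx|mx] := eqVneq (dot m x) c; last first.
  right; have [C C0 HC] := dot_bounded m.
  have d0 : 0 < `|dot m x - c| by rewrite normr_gt0 subr_eq0.
  exists (`|dot m x - c| / C), (dot m x <= c), (dot m x <= c).
  split; first by rewrite divr_gt0.
  move=> y yx; suff H : (dot m y <= c) <-> (dot m x <= c) by split=> _; exact: H.
  have H1 : `|dot m y - dot m x| < `|dot m x - c|.
    by rewrite -dotBr (le_lt_trans (HC _))// mulrC -ltr_pdivlMr.
  by split=> ?; move: H1; case: (ger0P (dot m x - c)) => ?; rewrite ltr_norml => /andP[]; lra.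
have [m0|m0] := eqVneq m 0.
  right; exists 1, true, true; split=> // y _.
  have z0 z : dot m z = 0 by rewrite m0 dotC dot0r.
  by rewrite /= -mx !z0 lexx.
have [t0|t0] := eqVneq (tangential m n) 0; last by left.
right; have nE z : dot n z = (dot n m / dot m m) * dot m z.
  move/eqP: t0; rewrite /tangential subr_eq0 => /eqP {1}->.
  by rewrite dotC dotZr [dot z m]dotC.
move: (dot n m / dot m m) nE => k nE.
exists 1, (0 <= k), (k <= 0); split=> // y _.
rewrite /= -mx -subr_le0 -dotBr; rewrite nE; set d := dot m _.
split; case: (ltrgtP k 0) => k0.
- by rewrite nmulr_rlt0// leNgt => ->.
- by rewrite pmulr_rlt0// => /ltW ->.
- by rewrite k0 mul0r ltxx.
- by rewrite nmulr_rgt0// => /ltW ->.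
- by rewrite pmulr_rgt0// leNgt => ->.
- by rewrite k0 mul0r ltxx.
Qed.

Lemma locally_sided_polyhedron (P : seq (seq (V * R))) n x :
  (forall h, h \in flatten P -> locally_sided [set y | dot h.1 y <= h.2] n x) ->
  locally_sided [set y | exists2 hs, hs \in P &
    forall h, h \in hs -> dot h.1 y <= h.2] n x.
Proof.
elim: P => [_|hs P IH Hh].
  rewrite (_ : mkset _ = [set _ | false]); first exact: locally_sided_const.
  by apply/seteqP; split => y // [].
have {}IH : locally_sided [set y | exists2 hs, hs \in P &
    forall h, h \in hs -> dot h.1 y <= h.2] n x.
  by apply: IH => h hP; apply: Hh; rewrite /= mem_cat hP orbT.
apply: (@locally_sided2 orb [set y | forall h, h \in hs -> dot h.1 y <= h.2]
    [set y | exists2 hs, hs \in P & forall h, h \in hs -> dot h.1 y <= h.2] _ _ _ _ _ IH).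
  move=> y a b Ha Hb; split=> [[hs']|/orP[/Ha H|/Hb [hs' hs'P H]]].
  - rewrite in_cons => /predU1P[-> H|hs'P H]; apply/orP; [left; exact/Ha|right; apply/Hb].
    by exists hs'.
  - by exists hs; rewrite ?mem_head.
  - by exists hs' => //; rewrite in_cons hs'P orbT.
have {Hh} : {in hs, forall h, locally_sided [set y | dot h.1 y <= h.2] n x}.
  by move=> h hhs; apply: Hh; rewrite /= mem_cat hhs.
elim: hs {IH} => [_|h hs IH Hh].
  rewrite (_ : mkset _ = [set _ | true]); first exact: locally_sided_const.
  by apply/seteqP; split.
apply: (@locally_sided2 andb [set y | dot h.1 y <= h.2]
    [set y | forall h, h \in hs -> dot h.1 y <= h.2]).
- move=> y a b Ha Hb; split=> [H|/andP[/Ha H /Hb H'] h'].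
    apply/andP; split; first by apply/Ha; apply: H; rewrite mem_head.
    by apply/Hb => h' h'hs; apply: H; rewrite in_cons h'hs orbT.
  by rewrite in_cons => /predU1P[->//|]; exact: H'.
- by apply: Hh; rewrite mem_head.
- by apply: IH => h' h'hs; apply: Hh; rewrite in_cons h'hs orbT.
Qed.

(** The exceptional set consists of the intersections of [S] with the bounding
    hyperplanes of [K] that are not parallel to it. *)
Lemma polyhedral_locally_sided K n S : polyhedral K -> compact S ->
  is_unit_normal S n -> exists B : set V,
    [/\ B `<=` S, forall v, vol (prism v B) = 0 &
      forall x, S x -> ~ B x -> locally_sided K n x].
Proof.
move=> [P ->] cS nS.
pose bad (h : V * R) := [set x : V | [/\ h.1 != 0, tangential h.1 n != 0 & dot h.1 x = h.2]].
exists [set x | exists2 h, h \in flatten P & (S `&` bad h) x]; split.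
- by move=> x [h _ []].
- move=> v; apply: (@vol_bigsetU_null _ _ _ (flatten P) (fun h => prism v (S `&` bad h))).
  - move=> h _; apply: bounded_prism.
    by apply: (sub_bounded_set (@subIsetl _ _ _)); exact: compact_bounded.
  - move=> h _; have [[h0 t0]|nh] := pselect (h.1 != 0 /\ tangential h.1 n != 0); last first.
      rewrite (_ : prism _ _ = set0) ?vol0// -subset0.
      by move=> y [x [_ [h0 t0 _]] _]; apply: nh.
    have cSh : compact (S `&` bad h).
      apply: (subclosed_compact _ cS); last exact: subIsetl.
      apply: closedI; first exact: compact_closed_rV.
      rewrite (_ : bad h = [set x | dot h.1 x = h.2]); first exact: closed_hyperplane.
      by apply/seteqP; split => [x []|x] //.
    apply: (vol_prism_codim2 _ _ cSh h0 t0).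
      by apply: sub_unit_normal nS; exact: subIsetl.
    by move=> x y [_ [_ _ ->]] [_ [_ _ ->]].
  - move=> y /prismP[x [t [[h hP hx] t01 ->]]]; exists h => //.
    by apply/prismP; exists x, t.
- move=> x Sx nB; apply: locally_sided_interior; apply: locally_sided_polyhedron => h hP.
  have [bh|//] := halfspace_locally_sided h n x.
  by case: nB; exists h.
Qed.

End area_theory.

(** * Points where a face separates a polyhedron from its complement *)

Section regular_points.
Context (R : realType) (l : nat).
Local Notation V := 'rV[R]_l.
Implicit Types (A B S K s : set V) (n v w x y e : V).

Definition sided_points K n s a b (N : nat) : set V :=
  [set x | s x /\ sided K n x N.+1%:R^-1 a b].

(** Closedness holds because [dot n] is constant on [s]: the side of [y] with
    respect to a limit point is its side with respect to nearby points of [s]. *)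
Lemma compact_sided_points K n s a b N : compact s -> is_unit_normal s n ->
  compact (sided_points K n s a b N).
Proof.
move=> cs ns; apply: (subclosed_compact _ cs); last by move=> x [].
apply/closed_approx => x Hx.
have sx : s x.
  apply: (closed_approx s).1; first exact: compact_closed_rV.
  by move=> d d0; have [x' [sx' _] xx'] := Hx d d0; exists x'.
split=> // y yx.
have [|x' [sx' Hx'] xx'] := Hx (N.+1%:R^-1 - `|y - x|); first by rewrite subr_gt0.
have -> : dot n (y - x) = dot n (y - x').
  by rewrite !dotBr (unit_normal_flat ns sx sx').
apply: Hx'; rewrite -[y](subrK x) -addrA (le_lt_trans (ler_normD _ _))//.
by rewrite -ltrBrDl.
Qed.

Lemma sub_sided_points K n s a b N M : (N <= M)%N ->
  sided_points K n s a b N `<=` sided_points K n s a b M.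
Proof.
move=> NM x [sx Hx]; split=> //; apply: sub_sided Hx.
by rewrite lef_pV2 ?posrE// ler_nat.
Qed.

(** The points of [s] near which [K] is the half-space opposite to [n], up to
    the hyperplane of [s]. *)
Definition regular_part K n s : set V :=
  \bigcup_N sided_points K n s true false N.

(** Almost every point of [s] has a neighbourhood where [K] is determined by the
    side of [s]. If [K] is not there the side opposite to [n], then [n] does not
    point out of [K]: such points form a countable union of compact subsets of
    the set of area zero in [outward]. *)
Lemma vol_prism_irregular K n s v : polyhedral K -> compact s ->
  is_unit_normal s n -> outward K s n ->
  vol (prism v (s `\` regular_part K n s)) = 0.
Proof.
move=> pK cs ns out.
have [B [Bs B0 HB]] := polyhedral_locally_sided pK cs ns.
have bs := compact_bounded cs.
rewrite /outward in out; set E := mkset _ in out.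
have bE : bounded_set E by apply: (sub_bounded_set _ bs) => x [].
have nE : is_unit_normal E n by apply: sub_unit_normal ns => x [].
have SE a b N : ~~ (a && ~~ b) -> sided_points K n s a b N `<=` E.
  move=> ab x [sx Hx]; split=> // -[d d0 Hd].
  have N0 : 0 < N.+1%:R^-1 :> R by rewrite invr_gt0.
  have [c c0 Hc] := scale_small n N0.
  pose t := Num.min (d / 2) c.
  have t0 : 0 < t by rewrite lt_min divr_gt0.
  have td : t < d.
    by rewrite (@le_lt_trans _ _ (d / 2)) ?ge_min ?lexx// ltr_pdivrMr// ltr_pMr// ltr1n.
  have tn : `|t *: n| < N.+1%:R^-1.
    by apply: Hc; rewrite gtr0_norm// ge_min lexx orbT.
  have nn := unit_normal_unit ns.
  have [|K1 K2] := Hd t; first by rewrite t0.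
  have [|a1 _] := Hx (x - t *: n); first by rewrite addrC addKr normrN.
  have [|_ b1] := Hx (x + t *: n); first by rewrite addrC addKr.
  move/negP: ab; apply; apply/andP; split.
    apply/a1 => //; rewrite addrC addKr -scaleNr dotZr nn mulr1 oppr_lt0//.
  apply/negP => bt; apply: K2; apply/b1 => //.
  by rewrite addrC addKr dotZr nn mulr1.
(* The three local pictures of [K] other than the regular one. *)
pose r := [:: (true, true); (false, true); (false, false)].
pose F N := [set y | exists2 p, p \in r & prism v (sided_points K n s p.1 p.2 N) y].
pose G N := if N is N'.+1 then F N' else prism v B.
have bp p N : bounded_set (prism v (sided_points K n s p.1 p.2 N)).
  by apply/bounded_prism/compact_bounded/compact_sided_points.
apply: (@vol_bigcup0 _ _ G).
- case=> [|N]; first by apply/bounded_prism/(sub_bounded_set Bs).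
  by apply: bounded_bigsetU => p _; exact: bp.
- case=> [|N]; first exact: B0.
  apply: (@vol_bigsetU_null _ _ _ r _ _ _ _ (@subset_refl _ _)) => p pr //.
  apply: (area0_sub_prism v out bE nE); first exact: compact_sided_points.
  by apply: SE; move: pr; rewrite !inE => /or3P[] /eqP ->.
- move=> y /prismP[x [t [[sx nr] t01 ->]]].
  have [Bx|nB] := pselect (B x); first by exists 0%N => //; apply/prismP; exists x, t.
  have [d [a [b [d0 Hd]]]] := HB x sx nB.
  have [N _ /(_ N (leqnn _)) Nd] := near_infty_natSinv_lt (PosNum d0).
  have xN : sided_points K n s a b N x by split=> //; exact: sub_sided (ltW Nd) Hd.
  exists N.+1 => //; exists (a, b); last by apply/prismP; exists x, t.
  by case: (a) (b) xN => [] [] xN; rewrite !inE ?eqxx ?orbT//; case: nr; exists N.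
Qed.

Lemma cvg_area_regular K n s v : polyhedral K -> compact s ->
  is_unit_normal s n -> outward K s n ->
  vol (prism v (sided_points K n s true false N)) @[N --> \oo] --> vol (prism v s).
Proof.
move=> pK cs ns out; have bs := compact_bounded cs.
have -> : vol (prism v s) = vol (\bigcup_N prism v (sided_points K n s true false N)).
  rewrite -[RHS](volU_null _ _ (vol_prism_irregular v pK cs ns out)).
  - congr vol; apply/seteqP; split => y.
      move=> /prismP[x [t [sx t01 ->]]].
      have [[N _ xN]|nr] := pselect (regular_part K n s x); [left|right].
        by exists N => //; apply/prismP; exists x, t.
      by apply/prismP; exists x, t.
    move=> [[N _]|]; apply: sub_prism; [by move=> x []|exact: subDsetl].
  - apply: (sub_bounded_set _ (bounded_prism v bs)) => y [N _].
    by apply: sub_prism => x [].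
  - by apply: bounded_prism; apply: sub_bounded_set bs; exact: subDsetl.
apply: vol_bigcup_cvg.
- by move=> N; apply: compact_closed_rV; apply: compact_prism; exact: compact_sided_points.
- by move=> N M NM; apply/sub_prism/sub_sided_points.
- apply: (sub_bounded_set _ (bounded_prism v bs)) => y [N _].
  by apply: sub_prism => x [].
Qed.

End regular_points.

(** * The divergence theorem for constant fields on a polyhedron *)

Section divergence.
Context (R : realType) (l : nat).
Local Notation V := 'rV[R]_l.
Implicit Types (s : set V) (n v w x y e : V).

Lemma polyhedral_open (K : set V) : polyhedral K -> open K.
Proof. by move=> [P ->]; exact: open_interior. Qed.

Lemma open_approx (K : set V) x : open K -> K x ->
  exists2 r : R, 0 < r & forall y, `|y - x| < r -> K y.
Proof.
move=> oK Kx; have /nbhs_ballP[r r0 rK] : nbhs x K by exact: open_nbhs_nbhs.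
by exists r => // y yx; apply: rK; rewrite -ball_normE/= distrC.
Qed.

Lemma open_line (K : set V) x e : open K -> K x ->
  exists2 d : R, 0 < d & forall u, `|u| < d -> K (x + u *: e).
Proof.
move=> oK Kx; have [r r0 rK] := open_approx oK Kx.
have [d d0 Hd] := scale_small e r0; exists d => // u ud.
by apply: rK; rewrite addrC addKr Hd// ltW.
Qed.

Lemma bdry_open (K : set V) x : open K -> bdry K x ->
  ~ K x /\ (forall d : R, 0 < d -> exists2 y, K y & `|x - y| < d).
Proof.
move=> oK [clx nKx]; split=> [Kx|d d0].
  by apply: nKx; exact: open_nbhs_nbhs.
have [y [Ky]] := clx (ball x d) (nbhsx_ballx _ _ d0).
by rewrite -ball_normE; exists y.
Qed.

(** The first parameter at which the segment is not in [K]. *)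
Lemma exit_point (K : set V) x e : open K -> K x -> ~ K (x + e) ->
  exists t : R, [/\ 0 < t, t <= 1, bdry K (x + t *: e) &
    forall u, 0 <= u < t -> K (x + u *: e)].
Proof.
move=> oK Kx nKe.
pose A := [set t : R | 0 <= t <= 1 /\ ~ K (x + t *: e)].
have A1 : A 1 by split; rewrite ?scale1r// ler01 lexx.
have lbA : lbound A 0 by move=> t [/andP[]].
have hA : has_inf A by split; [exists 1|exists 0].
have tA t : A t -> inf A <= t by move=> At; apply: ge_inf => //; exists 0.
have t0 : 0 <= inf A by apply: lb_le_inf => //; exists 1.
have t1 : inf A <= 1 by exact: tA.
have Ku u : 0 <= u < inf A -> K (x + u *: e).
  move=> /andP[u0 ut]; apply: contrapT => nKu.
  suff : inf A <= u by rewrite leNgt ut.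
  by apply: tA; split=> //; rewrite u0 (le_trans (ltW ut)).
have nKt : ~ K (x + inf A *: e).
  move=> Kt; have [d d0 Kd] := open_line e oK Kt.
  suff : inf A + d <= inf A by rewrite gerDl leNgt d0.
  apply: lb_le_inf; first by exists 1.
  move=> t [/andP[t0' t1'] nKt]; rewrite leNgt; apply/negP => td; apply: (nKt).
  have -> : x + t *: e = x + inf A *: e + (t - inf A) *: e.
    by rewrite -addrA -scalerDl subrKC.
  apply: Kd; rewrite ger0_norm ?ltrBlDl//.
  by rewrite subr_ge0; apply: tA; split=> //; rewrite t0' t1'.
have t0' : 0 < inf A.
  rewrite lt_neqAle t0 andbT; apply/negP => /eqP t00.
  by apply: nKt; rewrite -t00 scale0r addr0.
exists (inf A); split=> //; split; last by move/interior_subset.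
move=> B /nbhs_ballP[r r0 rB].
have [c c0 Hc] := scale_small e r0; pose d := Num.min (inf A) c.
have d0 : 0 < d by rewrite lt_min t0'.
exists (x + (inf A - d) *: e); split.
  by apply: Ku; rewrite subr_ge0 ge_min lexx/= ltrBlDr ltrDl.
apply: rB; rewrite -ball_normE/= scalerBl opprD opprB addrACA subrr add0r.
by rewrite addrC subrK Hc// gtr0_norm// ge_min lexx orbT.
Qed.

Context (K : set V) (E : seq (set V)) (nu : set V -> V).
Context (pK : polyhedral K) (bK : bounded_set K) (uE : uniq E).
Context (cE : {in E, forall s, compact s}).
Context (nE : {in E, forall s, is_unit_normal s (nu s)}).
Context (oE : {in E, forall s, outward K s (nu s)}).
Context (subE : {in E, forall s, s `<=` bdry K}).
Context (covE : forall x, bdry K x -> exists2 s, s \in E & s x).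
Context (ovE : {in E &, forall s s', s != s' -> area (s `&` s') = 0}).

(** The points that enter [K] under the translation by [e]. *)
Let swept e : set V := translate e K `\` K.

Let oK : open K := polyhedral_open pK.

Let bswept e : bounded_set (swept e).
Proof. by apply: (sub_bounded_set (@subDsetl _ _ _)); exact: bounded_translate. Qed.

Let vol_split (A : set V) : bounded_set A -> vol A = vol (A `&` K) + vol (A `\` K).
Proof.
move=> bA.
have mK : (lebesgue_outer R l).-caratheodory K by exact: open_measurable_rV.
have bI : bounded_set (A `&` K) by apply: (sub_bounded_set (@subIsetl _ _ _)).
have bD : bounded_set (A `\` K) by apply: (sub_bounded_set (@subDsetl _ _ _)).
by apply: EFin_inj; rewrite EFinD !volK//; exact: mK.
Qed.

(** A translate of [swept (- e)] is what [K] loses under the translation by [e];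
    what it gains has the same volume because [K] and its translate do. *)
Let vol_swept_opp e : vol (swept (- e)) = vol (swept e).
Proof.
have bT : bounded_set (translate e K) by exact: bounded_translate.
have H : vol (swept (- e)) = vol (K `\` translate e K).
  rewrite -(vol_translate e (swept (- e))); congr vol.
  rewrite /swept; apply/seteqP; split=> x; rewrite /translate/=.
    by rewrite opprK subrK.
  by rewrite opprK subrK.
have mT : (lebesgue_outer R l).-caratheodory (translate e K).
  apply: open_measurable_rV; rewrite -[translate e K]setCK; apply: closed_openC.
  exact: (@closed_translate _ _ e (~` K) (open_closedC oK)).
have bI : bounded_set (K `&` translate e K) by apply: (sub_bounded_set (@subIsetl _ _ _)).
have bD : bounded_set (K `\` translate e K) by apply: (sub_bounded_set (@subDsetl _ _ _)).
have H' : vol K = vol (K `&` translate e K) + vol (K `\` translate e K).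
  by apply: EFin_inj; rewrite EFinD !volK//; exact: mT.
have := vol_split bT; rewrite vol_translate H' -/(swept e) setIC H.
by move/addrI.
Qed.

Let flux_plus e : R := \sum_(s <- E) Num.max 0 (dot (nu s) e) * area s.

(** A point swept in by [e] comes from [K] and leaves it: it lies in the prism
    over the face of exit. That exit is through a face with [0 <= dot (nu s) e],
    or at one of the negligible points where a face does not separate [K] from
    its complement. *)
Let vol_swept_le e : vol (swept e) <= flux_plus e.
Proof.
pose G s := if 0 <= dot (nu s) e then s else s `\` regular_part K (nu s) s.
have Gs s : G s `<=` s by rewrite /G; case: ifP => _ //; exact: subDsetl.
have bG s : s \in E -> bounded_set (prism e (G s)).
  by move=> sE; apply: bounded_prism; apply: (sub_bounded_set (Gs s)); exact/compact_bounded/cE.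
apply: (@le_trans _ _ (\sum_(s <- E) vol (prism e (G s)))); last first.
  rewrite /flux_plus big_seq [leRHS]big_seq; apply: ler_sum => s sE.
  rewrite /G; case: ifPn => [s0|].
    by rewrite (vol_prism_area _ (cE sE) (nE sE)) ger0_norm// max_r.
  rewrite -ltNge => s0.
  rewrite (vol_prism_irregular e pK (cE sE) (nE sE) (oE sE)) mulr_ge0 ?area_ge0//.
  by rewrite le_max lexx.
apply: vol_bigsetU_le => [s|y [/= Ky nKy]]; first exact: bG.
have [|t [t0 t1 bz Ku]] := @exit_point K (y - e) e oK Ky; first by rewrite subrK.
set z := _ + t *: e in bz.
have [s sE sz] := covE bz; exists s => //.
apply/prismP; exists z, (1 - t); split=> //; last 2 first.
- by rewrite subr_ge0 t1/= lerBlDr lerDl ltW.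
- by rewrite /z -addrA -scalerDl addrC [t + _]addrC subrK scale1r addrC subrK.
rewrite /G; case: ifPn => //; rewrite -ltNge => s0; split=> // -[N _ [_ Hz]].
have N0 : 0 < N.+1%:R^-1 :> R by rewrite invr_gt0.
have [c c0 Hc] := scale_small e N0; pose d := Num.min t c.
have dp : 0 < d by rewrite lt_min t0.
have Kw : K (z - d *: e).
  rewrite /z -addrA -scalerBl; apply: Ku.
  by rewrite subr_ge0 ge_min lexx/= ltrBlDr ltrDl.
have [|_ H] := Hz (z - d *: e).
  by rewrite addrC addKr normrN Hc// gtr0_norm// ge_min lexx orbT.
have : false by apply/H => //; rewrite addrC addKr -scaleNr dotZr nmulr_lgt0// oppr_lt0.
by [].
Qed.

Let regular s N := sided_points K (nu s) s true false N.

Let regularW s N : regular s N `<=` s. Proof. by move=> x []. Qed.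

Let no_face_outside s s' N x x' : s \in E -> s x -> regular s' N x' ->
  `|x - x'| < N.+1%:R^-1 -> ~ 0 < dot (nu s') (x - x').
Proof.
move=> sE sx [sx' Hx'] xx' nx; have [_ clx] := bdry_open oK (subE sE sx).
have [d d0 Hd] := dot_gt0_near nx.
have [|y Ky xy] := clx (Num.min d (N.+1%:R^-1 - `|x - x'|)).
  by rewrite lt_min d0 subr_gt0.
move: xy; rewrite lt_min distrC => /andP[yd yN].
have [|_ H] := Hx' y.
  by rewrite -[y](subrK x) -addrA (le_lt_trans (ler_normD _ _))// -ltrBrDr.
by have : false by apply/H => //; exact: Hd.
Qed.

(** The prisms over regular points grow out of [K], so that a base point of one
    prism is never inside another one. *)
Let no_overlap s s' N x x' e (t t' : R) : s \in E -> s x -> regular s' N x' ->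
  `|e| < N.+1%:R^-1 -> 0 < dot (nu s') e -> 0 <= t -> t' <= 1 ->
  x + t *: e = x' + t' *: e -> t' <= t.
Proof.
move=> sE sx rx' eN s0 t0 t1 xx'; rewrite leNgt; apply/negP => tt'.
have xE : x - x' = (t' - t) *: e.
  by apply/eqP; rewrite scalerBl subr_eq addrAC [_ + x']addrC -xx' addrK.
apply: (no_face_outside sE sx rx'); rewrite xE.
  rewrite normrZ gtr0_norm ?subr_gt0// (le_lt_trans _ eN)// ler_piMl//.
  by rewrite lerBlDr ler_wpDr.
by rewrite dotZr mulr_gt0// subr_gt0.
Qed.

(** Short prisms over the regular parts of the faces with [0 < dot (nu s) e]
    are swept in and, up to negligible sets, do not overlap. *)
Let le_vol_swept e N : `|e| < N.+1%:R^-1 ->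
  \sum_(s <- E) Num.max 0 (dot (nu s) e) * area (regular s N) <= vol (swept e).
Proof.
move=> eN.
pose F s := if 0 < dot (nu s) e then prism e (regular s N) else set0.
have creg s : s \in E -> compact (regular s N).
  by move=> sE; apply: compact_sided_points; [exact: cE|exact: nE].
have nreg s : s \in E -> is_unit_normal (regular s N) (nu s).
  by move=> sE; exact: sub_unit_normal (@regularW s N) (nE sE).
have -> : \sum_(s <- E) Num.max 0 (dot (nu s) e) * area (regular s N) =
    \sum_(s <- E) vol (F s).
  rewrite big_seq [RHS]big_seq; apply: eq_bigr => s sE.
  rewrite /F; case: ltP => s0; last by rewrite mul0r vol0.
  by rewrite (vol_prism_area _ (creg _ sE) (nreg _ sE)) gtr0_norm.
(* The upper ends of the prisms are not swept in: translated back, they are on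
   the boundary of [K]. They form a null set. *)
pose top : set V := [set x | exists2 s, s \in E & translate e s x].
have btop : bounded_set top.
  by apply: bounded_bigsetU => s sE; apply: bounded_translate; exact/compact_bounded/cE.
have top0 : vol top = 0.
  apply: (@vol_bigsetU_null _ _ _ E (fun s => translate e s)).
  - by move=> s sE; apply: bounded_translate; exact/compact_bounded/cE.
  - move=> s sE; rewrite vol_translate (@vol_flat _ _ (nu s))//.
    + by rewrite -dot_eq0 (unit_normal_unit (nE sE)) oner_eq0.
    + exact: unit_normal_flat (nE sE).
    + exact/compact_bounded/cE.
  - by [].
rewrite -(volU_null (bswept e) btop top0).
apply: sum_vol_disjoint => //.
- move=> s sE; rewrite /F; case: ifP => _; last exact: closed0.
  by apply: compact_closed_rV; apply: compact_prism; exact: creg.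
- exact: bounded_setU2.
- move=> s sE y; rewrite /F; case: ifP => // s0 /prismP[x [t [[sx Hx] /andP[t0 t1] ->]]].
  have [nKx _] := bdry_open oK (subE sE sx).
  have te u : 0 <= u <= 1 -> `|u *: e| < N.+1%:R^-1.
    move=> /andP[u0 u1]; rewrite normrZ ger0_norm//.
    by rewrite (le_lt_trans _ eN)// ler_piMl.
  have [->|tn1] := eqVneq t 1.
    by right; exists s => //; rewrite /translate/= scale1r addrK.
  left; split.
    have {}t1 : t < 1 by rewrite lt_neqAle tn1.
    rewrite /translate/= -addrA -{2}[e]scale1r -scalerBl.
    have [|H _] := Hx (x + (t - 1) *: e).
      by rewrite addrC addKr -opprB scaleNr normrN te// subr_ge0 ltW//= gerBl.
    by apply/H => //; rewrite addrC addKr dotZr nmulr_rlt0// subr_lt0.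
  have [->|tn0] := eqVneq t 0; first by rewrite scale0r addr0.
  have [|_ H] := Hx (x + t *: e); first by rewrite addrC addKr te// t0.
  move/H; suff: 0 < dot (nu s) (x + t *: e - x) by move=> -> /(_ isT).
  by rewrite addrC addKr dotZr mulr_gt0// lt_neqAle eq_sym tn0.
- move=> s s' sE s'E ss'.
  have H : F s `&` F s' `<=` prism e (s `&` s').
    move=> y; rewrite /F; case: ifP => s0; last by case.
    case: ifP => s0'; last by case.
    move=> [/prismP[x [t [rx /andP[t0 t1] ->]]] /prismP[x' [t' [rx' /andP[t0' t1']]]]].
    move=> xx'; have [sx sx'] : s x /\ s' x' by split; [case: rx|case: rx'].
    have tt' : t' = t.
      apply/eqP; rewrite eq_le (no_overlap sE sx rx' eN s0' t0 t1' xx').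
      by rewrite (no_overlap s'E sx' rx eN s0 t0' t1 (esym xx')).
    apply/prismP; exists x, t; rewrite t0 t1; split=> //; split=> //.
    by move: xx'; rewrite tt' => /addIr ->.
  apply/eqP; rewrite eq_le vol_ge0 andbT.
  have css' : compact (s `&` s').
    by apply: subclosed_compact (@subIsetl _ _ _); [apply: closedI; apply: compact_closed_rV; exact: cE|exact: cE].
  have -> : 0 = vol (prism e (s `&` s')).
    rewrite (vol_prism_area _ css' (sub_unit_normal (@subIsetl _ _ _) (nE sE))).
    by rewrite ovE// mulr0.
  by apply: le_vol => //; apply: bounded_prism; exact: compact_bounded.
Qed.

Let cvg_flux_plus e (r : seq (set V)) : {subset r <= E} ->
  \sum_(s <- r) Num.max 0 (dot (nu s) e) * area (regular s N) @[N --> \oo] -->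
  \sum_(s <- r) Num.max 0 (dot (nu s) e) * area s.
Proof.
elim: r => [_|s r IH sr].
  by rewrite big_nil; under eq_fun do rewrite big_nil; exact: cvg_cst.
rewrite big_cons; under eq_fun do rewrite big_cons.
have sE : s \in E by apply: sr; rewrite mem_head.
apply: cvgD; last by apply: IH => s' s'r; apply: sr; rewrite in_cons s'r orbT.
apply: cvgMr.
have areaE (A : set V) : compact A -> A `<=` s -> area A = vol (prism (nu s) A).
  move=> cA As; have nA := sub_unit_normal As (nE sE).
  by rewrite (vol_prism_area _ cA nA) (unit_normal_unit nA) normr1 mul1r.
rewrite (areaE s (cE sE))//.
have -> : (fun N => area (regular s N)) = (fun N => vol (prism (nu s) (regular s N))).
  apply/funext => N; apply: areaE; last exact: regularW.
  exact: compact_sided_points (cE sE) (nE sE).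
exact: (cvg_area_regular pK (cE sE) (nE sE) (oE sE)).
Qed.

(** Scaling [e] down makes the prisms over the regular parts of level [N] short
    enough; then [N] tends to infinity. *)
Let flux_plus_opp e : flux_plus e <= flux_plus (- e).
Proof.
have H : {subset E <= E} by [].
apply: (cvgr_to_le (@cvg_flux_plus e E H)); apply: nearW => N {H}.
have N0 : 0 < N.+1%:R^-1 :> R by rewrite invr_gt0.
have [t t0 /(_ t)] := scale_small e N0; rewrite gtr0_norm// => /(_ (lexx _)) te.
have := le_vol_swept te; rewrite -vol_swept_opp => /le_trans /(_ (vol_swept_le _)).
have maxZ s w : Num.max 0 (dot (nu s) (t *: w)) = t * Num.max 0 (dot (nu s) w).
  by rewrite dotZr maxr_pMr ?mulr0// ltW.
rewrite /flux_plus -scalerN.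
under eq_bigr do rewrite maxZ -mulrA.
under [leRHS]eq_bigr do rewrite maxZ -mulrA.
by rewrite -!mulr_sumr ler_pM2l.
Qed.

(** The flux of [e] is the difference of [flux_plus e], over the faces crossed
    outwards, and [flux_plus (- e)], over the others. Both are, to first order,
    the volume swept in by a short multiple of [e] or of [- e], and these two
    volumes are equal. *)
Lemma polyhedral_divergence e : \sum_(s <- E) dot (nu s) e * area s = 0.
Proof.
have -> : \sum_(s <- E) dot (nu s) e * area s = flux_plus e - flux_plus (- e).
  rewrite /flux_plus -sumrB; apply: eq_bigr => s _; rewrite -mulrBl; congr (_ * _).
  rewrite dotNr; set d := dot _ _.
  by case: (leP 0 d) => d0; [rewrite max_l ?subr0// oppr_le0|
    rewrite max_r ?sub0r ?opprK// oppr_ge0 ltW].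
by apply/eqP; rewrite subr_eq0 eq_le flux_plus_opp -{2}[e]opprK flux_plus_opp.
Qed.

End divergence.

(** * Interfaces of disjoint polyhedra *)

Section cell_interfaces.
Context (R : realType) (l : nat).
Local Notation V := 'rV[R]_l.
Implicit Types (A B S s : set V) (n x y : V).

(** An open set adherent to [x] has points near [x] off the hyperplane through
    [x] normal to [n]. *)
Lemma sided_closure A n x (r : R) a b : open A -> closure A x -> dot n n = 1 ->
  0 < r -> sided A n x r a b -> a || b.
Proof.
move=> oA clx n1 r0 HA.
have [y [Ay]] := clx (ball x r) (nbhsx_ballx _ _ r0).
rewrite -ball_normE/= distrC => yx.
have off z : A z -> `|z - x| < r -> dot n (z - x) != 0 -> a || b.
  move=> Az zx; have [Ha Hb] := HA z zx.
  by rewrite neq_lt => /orP[/Ha/iffLR/(_ Az)->|/Hb/iffLR/(_ Az)->]; rewrite ?orbT.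
have [y0|] := eqVneq (dot n (y - x)) 0; last exact: off.
have [d d0 Hd] := open_line n oA Ay.
have [e e0 He] : exists2 e : R, 0 < e & forall u, `|u| < e -> `|y + u *: n - x| < r.
  have oB : open (ball x r) by exact: ball_open.
  have Bxy : ball x r y by rewrite -ball_normE/= distrC.
  have [e e0 He] := open_line n oB Bxy.
  by exists e => // u /He; rewrite -ball_normE/= distrC.
pose u := Num.min d e / 2.
have u0 : 0 < u by rewrite divr_gt0// lt_min d0.
have um : u < Num.min d e by rewrite /u ltr_pdivrMr// ltr_pMr ?ltr1n// lt_min d0.
move: (um); rewrite lt_min => /andP[ud ue].
apply: (off (y + u *: n)).
- by apply: Hd; rewrite gtr0_norm.
- by apply: He; rewrite gtr0_norm.
- by rewrite addrAC dotDr y0 add0r dotZr n1 mulr1 gt_eqF.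
Qed.

Lemma sided_disjoint A B n x (r r' : R) a b a' b' : A `&` B = set0 -> dot n n = 1 ->
  0 < r -> 0 < r' -> sided A n x r a b -> sided B n x r' a' b' ->
  ~~ (a && a') && ~~ (b && b').
Proof.
move=> AB n1 r0 r'0 HA HB.
have m0 : 0 < Num.min r r' by rewrite lt_min r0.
have [e e0 /(_ e)] := scale_small n m0; rewrite gtr0_norm// => /(_ (lexx _)).
rewrite lt_min => /andP[er er'].
have disj z : A z -> B z -> False.
  by move=> Az Bz; have : (A `&` B) z by []; rewrite AB.
apply/andP; split; apply/negP => /andP[h h'].
  have zE : x - e *: n - x = - (e *: n) by rewrite addrAC subrr add0r.
  have [|H _] := HA (x - e *: n); first by rewrite zE normrN.
  have [|H' _] := HB (x - e *: n); first by rewrite zE normrN.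
  have neg : dot n (x - e *: n - x) < 0 by rewrite zE dotNr dotZr n1 mulr1 oppr_lt0.
  by apply: disj; [apply/(H neg)|apply/(H' neg)].
have zE : x + e *: n - x = e *: n by rewrite addrAC subrr add0r.
have [|_ H] := HA (x + e *: n); first by rewrite zE.
have [|_ H'] := HB (x + e *: n); first by rewrite zE.
have pos : 0 < dot n (x + e *: n - x) by rewrite zE dotZr n1 mulr1.
by apply: disj; [apply/(H pos)|apply/(H' pos)].
Qed.

Lemma bounded_closure A : bounded_set A -> bounded_set (closure A).
Proof.
move=> /bounded_rVP[M HM]; apply/bounded_rVP; exists M => x clx.
apply/ler_addgt0Pr => e e0; have [y [/HM yM]] := clx (ball x e) (nbhsx_ballx _ _ e0).
rewrite -ball_normE/= => xy.
by rewrite -[x](subrK y) addrC (le_trans (ler_normD _ _))// lerD// ltW.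
Qed.

(** Only two sides of a flat set are available, and three disjoint open
    polyhedra cannot share them. *)
Lemma three_polyhedra_area0 A B C S n : polyhedral A -> polyhedral B -> polyhedral C ->
  A `&` B = set0 -> A `&` C = set0 -> B `&` C = set0 ->
  compact S -> is_unit_normal S n ->
  S `<=` closure A -> S `<=` closure B -> S `<=` closure C -> area S = 0.
Proof.
move=> pA pB pC AB AC BC cS nS SA SB SC.
have n1 := unit_normal_unit nS; have bS := compact_bounded cS.
have [NA [NAS NA0 HA]] := polyhedral_locally_sided pA cS nS.
have [NB [NBS NB0 HB]] := polyhedral_locally_sided pB cS nS.
have [NC [NCS NC0 HC]] := polyhedral_locally_sided pC cS nS.
have -> : area S = vol (prism n S) by rewrite (vol_prism_area _ cS nS) n1 normr1 mul1r.
apply: (@vol_bigsetU_null _ _ _ [:: NA; NB; NC] (prism n)).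
- by move=> N; rewrite !inE => /or3P[] /eqP ->; apply: bounded_prism;
    [exact: sub_bounded_set NAS bS|exact: sub_bounded_set NBS bS|exact: sub_bounded_set NCS bS].
- by move=> N; rewrite !inE => /or3P[] /eqP ->.
- move=> y /prismP[x [t [Sx t01 ->]]].
  have tP N : N x -> prism n N (x + t *: n) by move=> Nx; apply/prismP; exists x, t.
  have [/tP ?|nA] := pselect (NA x); first by exists NA; rewrite ?inE ?eqxx.
  have [/tP ?|nB] := pselect (NB x); first by exists NB; rewrite ?inE ?eqxx ?orbT.
  have [/tP ?|nC] := pselect (NC x); first by exists NC; rewrite ?inE ?eqxx ?orbT.
  have [r [a [a' [r0 sA]]]] := HA x Sx nA.
  have [s [b [b' [s0 sB]]]] := HB x Sx nB.
  have [q [c [c' [q0 sC]]]] := HC x Sx nC.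
  have := sided_closure (polyhedral_open pA) (SA x Sx) n1 r0 sA.
  have := sided_closure (polyhedral_open pB) (SB x Sx) n1 s0 sB.
  have := sided_closure (polyhedral_open pC) (SC x Sx) n1 q0 sC.
  have := sided_disjoint AB n1 r0 s0 sA sB.
  have := sided_disjoint AC n1 r0 q0 sA sC.
  have := sided_disjoint BC n1 s0 q0 sB sC.
  by case: (a) (a') (b) (b') (c) (c') => [] [] [] [] [] [].
Qed.

End cell_interfaces.

(** * Cells of a mesh *)

Section mesh_cells.
Context (R : realType) (l : nat).
Local Notation V := 'rV[R]_l.
Context (Omega : set V) (m : mesh R l) (hmesh : is_mesh Omega m)
  (bOmega : bounded_set Omega) (K : set V) (hK : K \in cells m).

Lemma bounded_cell : bounded_set K.
Proof. exact: sub_bounded_set (mesh_sub hmesh hK) bOmega. Qed.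

Lemma edge_sub_bdry s : s \in edges m K -> s `<=` bdry K.
Proof. by move=> sK x sx; rewrite -(mesh_edge_cover hmesh hK); exists s. Qed.

Lemma compact_edge s : s \in edges m K -> compact s.
Proof.
move=> sK; apply: bounded_closed_compact; last exact: (mesh_edge_closed hmesh hK sK).
apply: (sub_bounded_set _ (bounded_closure bounded_cell)) => x.
by move=> /(edge_sub_bdry sK)[].
Qed.

Lemma sum_area_normal w :
  \sum_(s <- edges m K) area s * dot w (normal m K s) = 0.
Proof.
under eq_bigr do rewrite mulrC dotC.
apply: (@polyhedral_divergence _ _ K (edges m K) (normal m K)).
- exact: (mesh_polyhedral hmesh hK).
- exact: bounded_cell.
- exact: fset_uniq.
- exact: compact_edge.
- by move=> s /(mesh_normal hmesh hK)[].
- by move=> s /(mesh_normal hmesh hK)[].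
- exact: edge_sub_bdry.
- by move=> x; rewrite -(mesh_edge_cover hmesh hK) => -[s sK sx]; exists s.
- exact: (mesh_edge_overlap hmesh hK).
Qed.

Lemma sum_edges (g : set V -> R) : \sum_(s <- edges m K) g s =
  \sum_(s <- int_edges Omega m K) g s + \sum_(s <- ext_edges Omega m K) g s.
Proof.
rewrite (bigID (fun s => s \in ext_edges Omega m K)) [LHS]addrC /=; congr (_ + _).
  rewrite -big_filter; apply: perm_big; apply: uniq_perm.
  - by rewrite filter_uniq ?fset_uniq.
  - exact: fset_uniq.
  - by move=> s; rewrite mem_filter /int_edges in_fsetD.
rewrite -big_filter; apply: perm_big; apply: uniq_perm.
- by rewrite filter_uniq ?fset_uniq.
- exact: fset_uniq.
- by move=> s; rewrite mem_filter /ext_edges !inE/= andbC andbA andbb.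
Qed.

Lemma interface_int_edge L : L \in neighbours m K ->
  interface K L \in int_edges Omega m K.
Proof. by move=> LK; rewrite (mesh_int_edges hmesh hK); apply/imfsetP; exists L. Qed.

Lemma interface_edge L : L \in neighbours m K -> interface K L \in edges m K.
Proof. by move=> /interface_int_edge; rewrite /int_edges in_fsetD => /andP[]. Qed.

(** If two neighbours shared their interface with [K], then three disjoint cells
    would be adherent to a flat set of positive area. *)
Lemma interface_inj : {in neighbours m K &, injective (interface K)}.
Proof.
move=> L L' LK L'K LL'; apply/eqP; apply/negPn/negP => nLL'.
have := LK; have := L'K; rewrite !inE/= => /and3P[L'c L'K' _] /and3P[Lc LK' a0].
have [nS _] := mesh_normal hmesh hK (interface_edge LK).
move: a0; rewrite lt_neqAle => /andP[/negP[]].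
rewrite eq_sym; apply/eqP; apply: (@three_polyhedra_area0 _ _ K L L' _ _ _ _ _ _ _ _ _ nS).
- exact: (mesh_polyhedral hmesh hK).
- exact: (mesh_polyhedral hmesh Lc).
- exact: (mesh_polyhedral hmesh L'c).
- by apply: (mesh_disjoint hmesh) => //; rewrite eq_sym.
- by apply: (mesh_disjoint hmesh) => //; rewrite eq_sym.
- exact: (mesh_disjoint hmesh).
- exact: compact_edge (interface_edge LK).
- exact: subIsetl.
- exact: subIsetr.
- by rewrite LL'; exact: subIsetr.
Qed.

Lemma sum_int_edges (g : set V -> set V -> R) :
  \sum_(s <- int_edges Omega m K) g s (across m K s) =
  \sum_(L <- neighbours m K) g (interface K L) L.
Proof.
rewrite (mesh_int_edges hmesh hK) big_imfset/=; last exact: interface_inj.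
rewrite big_seq [RHS]big_seq; apply: eq_bigr => L LK; congr (g _ _).
apply: xget_unique => // L' [L'K /esym]; exact: interface_inj.
Qed.

End mesh_cells.

(** * Discrete entropy inequalities for an implicit monotone scheme *)

Section discrete_entropy.
Context (R : realType) (I : eqType) (r : seq I).
Context (G : I -> R -> R -> R) (tau b : I -> R) (phi : R -> R) (v dt a a0 : R).
Context (v0 : 0 <= v) (dt0 : 0 < dt).
Context (tau0 : {in r, forall i, 0 <= tau i}).
Context (phiD : {homo phi : x y / x <= y}).
Context (Gr : {in r, forall i x, {homo G i x : y y' /~ y <= y'}}).
Context (step : v * ((a - a0) / dt) + \sum_(i <- r) G i a (b i)
  - \sum_(i <- r) tau i * (phi (b i) - phi a) = 0).

Let time_le (x y : R) : x <= y -> x / dt * v <= v * (y / dt).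
Proof. by move=> xy; rewrite [leRHS]mulrC ler_wpM2r// ler_wpM2r// invr_ge0 ltW. Qed.

Let ler_sumr (g g' : I -> R) : {in r, forall i, g i <= g' i} ->
  \sum_(i <- r) g i <= \sum_(i <- r) g' i.
Proof. by move=> gg'; rewrite big_seq [leRHS]big_seq; exact: ler_sum. Qed.

(** If [k < a], the terms of the left-hand side are bounded one by one by those of
    the scheme, up to the sum of the [G i k k]; if [a <= k], they are nonpositive. *)
Lemma discrete_sub_entropy k :
  (eta_plus k a - eta_plus k a0) / dt * v
  + \sum_(i <- r) Phi_plus (G i) k a (b i)
  - \sum_(i <- r) tau i * (eta_plus (phi k) (phi (b i)) - eta_plus (phi k) (phi a))
  <= - (sign_plus (a - k) * \sum_(i <- r) G i k k).
Proof.
rewrite /eta_plus /Phi_plus /sign_plus subr_gt0.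
case: ltP => [ka|ak].
  have H2 : \sum_(i <- r) (G i a (Num.max (b i) k) - G i k k) <=
      \sum_(i <- r) G i a (b i) - \sum_(i <- r) G i k k.
    rewrite -sumrB; apply: ler_sumr => i ir; rewrite lerD2r; apply: Gr => //.
    by rewrite le_max lexx.
  have H3 : \sum_(i <- r) tau i * (phi (b i) - phi a) <= \sum_(i <- r) tau i *
      (Num.max (phi (b i)) (phi k) - phi k - (Num.max (phi a) (phi k) - phi k)).
    apply: ler_sumr => i ir; rewrite ler_wpM2l ?tau0//.
    rewrite [Num.max (phi a) _]max_l; last by apply: phiD; exact: ltW.
    have : phi (b i) <= Num.max (phi (b i)) (phi k) by rewrite le_max lexx.
    lra.
  have H1 : (a - k - (Num.max a0 k - k)) / dt * v <= v * ((a - a0) / dt).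
    apply: time_le; have : a0 <= Num.max a0 k by rewrite le_max lexx.
    lra.
  by move: step H1 H2 H3; rewrite mul1r; lra.
have H1 : (k - k - (Num.max a0 k - k)) / dt * v <= v * (0 / dt).
  apply: time_le; have : k <= Num.max a0 k by rewrite le_max lexx orbT.
  lra.
have H2 : \sum_(i <- r) (G i k (Num.max (b i) k) - G i k k) <= 0.
  rewrite big_seq sumr_le0// => i ir; rewrite subr_le0; apply: Gr => //.
  by rewrite le_max lexx orbT.
have H3 : 0 <= \sum_(i <- r) tau i *
    (Num.max (phi (b i)) (phi k) - phi k - (Num.max (phi a) (phi k) - phi k)).
  rewrite big_seq sumr_ge0// => i ir; rewrite mulr_ge0 ?tau0//.
  rewrite [Num.max (phi a) _]max_r; last exact: phiD.
  have : phi k <= Num.max (phi (b i)) (phi k) by rewrite le_max lexx orbT.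
  lra.
by move: H1 H2 H3; rewrite mul0r !mulr0; lra.
Qed.

(** If [a < k], the terms of the left-hand side are bounded one by one by the
    opposites of those of the scheme, up to the sum of the [G i k k]; if [k <= a],
    they are nonpositive. *)
Lemma discrete_super_entropy k :
  (eta_minus k a - eta_minus k a0) / dt * v
  + \sum_(i <- r) Phi_minus (G i) k a (b i)
  - \sum_(i <- r) tau i * (eta_minus (phi k) (phi (b i)) - eta_minus (phi k) (phi a))
  <= - (sign_minus (a - k) * \sum_(i <- r) G i k k).
Proof.
rewrite /eta_minus /Phi_minus /sign_minus subr_lt0.
case: ltP => [ak|ka].
  have H2 : \sum_(i <- r) (G i k k - G i a (Num.min (b i) k)) <=
      \sum_(i <- r) G i k k - \sum_(i <- r) G i a (b i).
    rewrite -sumrB; apply: ler_sumr => i ir; rewrite lerD2l lerN2; apply: Gr => //.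
    by rewrite ge_min lexx.
  have H3 : - \sum_(i <- r) tau i * (phi (b i) - phi a) <= \sum_(i <- r) tau i *
      (phi k - Num.min (phi (b i)) (phi k) - (phi k - Num.min (phi a) (phi k))).
    rewrite -sumrN; apply: ler_sumr => i ir; rewrite -mulrN ler_wpM2l ?tau0//.
    rewrite [Num.min (phi a) _]min_l; last by apply: phiD; exact: ltW.
    have : Num.min (phi (b i)) (phi k) <= phi (b i) by rewrite ge_min lexx.
    lra.
  have H1 : (k - a - (k - Num.min a0 k)) / dt * v <= v * ((- (a - a0)) / dt).
    apply: time_le; have : Num.min a0 k <= a0 by rewrite ge_min lexx.
    lra.
  by move: step H1 H2 H3; rewrite mulNr mulrN mulN1r; lra.
have H1 : (k - k - (k - Num.min a0 k)) / dt * v <= v * (0 / dt).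
  apply: time_le; have : Num.min a0 k <= k by rewrite ge_min lexx orbT.
  lra.
have H2 : \sum_(i <- r) (G i k k - G i k (Num.min (b i) k)) <= 0.
  rewrite big_seq sumr_le0// => i ir; rewrite subr_le0; apply: Gr => //.
  by rewrite ge_min lexx orbT.
have H3 : 0 <= \sum_(i <- r) tau i *
    (phi k - Num.min (phi (b i)) (phi k) - (phi k - Num.min (phi a) (phi k))).
  rewrite big_seq sumr_ge0// => i ir; rewrite mulr_ge0 ?tau0//.
  rewrite [Num.min (phi a) _]min_r; last exact: phiD.
  have : Num.min (phi (b i)) (phi k) <= phi k by rewrite ge_min lexx orbT.
  lra.
by move: H1 H2 H3; rewrite mul0r !mulr0; lra.
Qed.

End discrete_entropy.

(** * The discrete entropy inequalities of the finite volume scheme *)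

Theorem lemma3p1 (R : realType) (l : nat) (hl : (1 <= l)%N)
    (Omega : set 'rV[R]_l) (T umax uc : R) (f : R -> 'rV[R]_l)
    (phi : R -> R) (u0 : 'rV[R]_l -> R)
    (hpb : problem_data Omega T umax uc f phi u0)
    (m : mesh R l) (alpha : R) (halpha : 0 < alpha)
    (hmesh : is_mesh Omega m) (hreg : regular_mesh alpha m)
    (hadm : admissible_mesh m)
    (M : R) (F : set 'rV[R]_l -> set 'rV[R]_l -> R -> R -> R)
    (hF : numerical_flux m umax f M F)
    (dt : R) (hdt : 0 < dt) (u : nat -> set 'rV[R]_l -> R)
    (hu : scheme_solution m F phi u0 dt u)
    (k : R) (hk : 0 <= k <= umax)
    (K : set 'rV[R]_l) (hK : K \in cells m) (n : nat) :
  (eta_plus k (u n.+1 K) - eta_plus k (u n K)) / dt * vol K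
  + \sum_(s <- int_edges Omega m K)
      Phi_plus (F K s) k (u n.+1 K) (u n.+1 (across m K s))
  - \sum_(L <- neighbours m K) transmissibility m K L *
      (eta_plus (phi k) (phi (u n.+1 L)) - eta_plus (phi k) (phi (u n.+1 K)))
  <= \sum_(s <- ext_edges Omega m K)
       sign_plus (u n.+1 K - k) * area s * dot (f k) (normal m K s)
  /\
  (eta_minus k (u n.+1 K) - eta_minus k (u n K)) / dt * vol K
  + \sum_(s <- int_edges Omega m K)
      Phi_minus (F K s) k (u n.+1 K) (u n.+1 (across m K s))
  - \sum_(L <- neighbours m K) transmissibility m K L *
      (eta_minus (phi k) (phi (u n.+1 L)) - eta_minus (phi k) (phi (u n.+1 K)))
  <= \sum_(s <- ext_edges Omega m K)
       sign_minus (u n.+1 K - k) * area s * dot (f k) (normal m K s).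
Proof.
have bO := pb_bounded hpb; have phiD := pb_phi_nondecreasing hpb.
pose G L := F K (interface K L).
have kI : k \in `[0, umax] by rewrite in_itv.
have EK L : L \in neighbours m K -> interface K L \in edges m K.
  exact: (interface_edge hmesh hK).
have tau0 : {in neighbours m K, forall L, 0 <= transmissibility m K L}.
  by move=> L _; rewrite divr_ge0 ?area_ge0// sqrtr_ge0.
have Gr : {in neighbours m K, forall L x, {homo G L x : y y' /~ y <= y'}}.
  by move=> L /EK LK; have [] := flux_monotone hF hK LK.
(* The faces of a cell balance: the flux of the constant state [k] through the
   interfaces is opposite to the one through the boundary faces. *)
have bal : \sum_(L <- neighbours m K) G L k k =
    - \sum_(s <- ext_edges Omega m K) area s * dot (f k) (normal m K s).
  have := sum_area_normal hmesh bO hK (f k).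
  rewrite (sum_edges Omega) => /eqP; rewrite addr_eq0 => /eqP <-.
  rewrite -(sum_int_edges hmesh bO hK (fun s _ => F K s k k)).
  rewrite big_seq [RHS]big_seq; apply: eq_bigr => s.
  by rewrite /int_edges in_fsetD => /andP[_ sK]; rewrite (flux_consistent hF hK sK).
have step := scheme_step hu n hK.
have sgn (c : R) : \sum_(s <- ext_edges Omega m K) c * area s * dot (f k) (normal m K s) =
    - (c * \sum_(L <- neighbours m K) G L k k).
  by rewrite bal mulrN opprK mulr_sumr; apply: eq_bigr => s _; rewrite mulrA.
rewrite !sgn.
rewrite (sum_int_edges hmesh bO hK (fun s L => Phi_plus (F K s) k (u n.+1 K) (u n.+1 L))).
rewrite (sum_int_edges hmesh bO hK (fun s L => Phi_minus (F K s) k (u n.+1 K) (u n.+1 L))).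
split.
  exact: (discrete_sub_entropy (vol_ge0 K) hdt tau0 phiD Gr step).
exact: (discrete_super_entropy (vol_ge0 K) hdt tau0 phiD Gr step).
Qed.
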